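(* Let $(W,I)$ be a Coxeter system and let $J\subset I$ be a subset such that $W_J$ is finite. Then the poset $\mathcal{Q}^J$ is Eulerian.
   Context: $W$ has simple reflections $s_i$, $i\in I$, length function $\ell$ and Bruhat order $\le$. $W_J=\langle s_j : j\in J\rangle$. $W^J$ (resp. $W^J_{max}$) is the set of minimal (resp. maximal) length coset representatives of $W/W_J$. Let $\mathcal{I}^J\subset W^J_{max}\times W_J\times W^J$ be the set of triples $(x,u,w)$ with $x\le wu$. The poset $\mathcal{Q}^J$ has elements $\{\hat 0\}\cup\{Q_{x,u,w} : (x,u,w)\in\mathcal{I}^J\}$ (distinct triples give distinct elements), with order relation: $Q_{x,u,w}\le Q_{x',u',w'}$ if and only if there exist $u_1,u_2\in W_J$ with $u_1u_2=u$ and $\ell(u)=\ell(u_1)+\ell(u_2)$ such that $x'u'^{-1}\le xu_2^{-1}\le wu_1\le w'$; and $\hat 0<Q_{x,u,w}$ for all $Q_{x,u,w}$. A finite graded poset with least and greatest elements (graded: all maximal chains have the same length) is Eulerian if every interval of length at least one has the same number of elements of odd rank as of even rank, where the rank of an element is the common length of all unrefinable chains from the least element to it.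
   Formalization: For infinite W the poset Q^J is infinite, so it is not literally Eulerian; the formal theorem proves Q^J Eulerian when W is finite, and for every W with W_J finite that Q^J is a poset with least element all of whose closed intervals are Eulerian. *)

(* Defs.v *)
From Stdlib Require Import Relation_Operators.
From mathcomp Require Import all_boot.
From mathcomp Require Import boolp classical_sets functions cardinality.

Set Implicit Arguments.
Unset Strict Implicit.
Unset Printing Implicit Defensive.

Local Open Scope classical_set_scope.
Local Open Scope card_scope.

(* All poset notions are relative to a subset A of a carrier type P, ordered
   by the restriction of le to A. *)
Section Posets.
Variables (P : Type) (le : P -> P -> Prop).
Implicit Types (A C : set P) (a b x y : P) (n : nat).

Definition partial_order_on A : Prop :=
  [/\ forall x, A x -> le x x,
      forall x y, A x -> A y -> le x y -> le y x -> x = y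
    & forall x y z, A x -> A y -> A z -> le x y -> le y z -> le x z].

Definition least_in A x : Prop := A x /\ forall y, A y -> le x y.

Definition greatest_in A x : Prop := A x /\ forall y, A y -> le y x.

Definition interval_in A a b : set P := [set x | [/\ A x, le a x & le x b]].

Definition maximal_chain A C : Prop :=
  [/\ C `<=` A, total_on C le
    & forall C', C' `<=` A -> total_on C' le -> C `<=` C' -> C' = C].

(* A chain of length n has n + 1 elements. *)
Definition chain_length C n : Prop := C #= `I_n.+1.

Definition graded A : Prop :=
  exists n, forall C, maximal_chain A C -> chain_length C n.

(* The unrefinable chains from a to b are the maximal chains of [a, b]. *)
Definition has_rank A x n : Prop :=
  exists2 bot, least_in A bot &
    (exists C, maximal_chain (interval_in A bot x) C) /\
    forall C, maximal_chain (interval_in A bot x) C -> chain_length C n.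

Definition eulerian A : Prop :=
  [/\ partial_order_on A, finite_set A,
      exists bot, least_in A bot,
      exists top, greatest_in A top
    & graded A /\
      forall a b, A a -> A b -> le a b -> a <> b ->
        [set x | interval_in A a b x /\ exists2 n, has_rank A x n & odd n] #=
        [set x | interval_in A a b x /\ exists2 n, has_rank A x n & ~~ odd n]].

(* The form of "Eulerian" that applies to a possibly infinite poset with a
   least element but possibly no greatest one. *)
Definition locally_eulerian A : Prop :=
  [/\ partial_order_on A, exists bot, least_in A bot
    & forall a b, A a -> A b -> le a b -> eulerian (interval_in A a b)].

End Posets.

Local Open Scope group_scope.

Section Coxeter.
Variable I : Type.

(* The entry 0 stands for infinity. *)
Definition coxeter_matrix (m : I -> I -> nat) : Prop :=
  [/\ forall i, m i i = 1%N, forall i j, m i j = m j i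
    & forall i j, i <> j -> m i j <> 1%N].

(* No relation is imposed when m i j = 0, since x ^+ 0 = 1. *)
Definition coxeter_relations (m : I -> I -> nat) (G : groupType) (f : I -> G) :
    Prop :=
  forall i j, (f i * f j) ^+ m i j = 1.

Definition is_subgroup (G : groupType) (H : set G) : Prop :=
  [/\ H 1, forall x y, H x -> H y -> H (x * y) & forall x, H x -> H x^-1].

Definition generated (G : groupType) (A : set G) : set G :=
  smallest (@is_subgroup G) A.

(* W is presented by the generators s i and the Coxeter relations of some
   Coxeter matrix. *)
Definition coxeter_system (W : groupType) (s : I -> W) : Prop :=
  exists m, [/\ coxeter_matrix m, coxeter_relations m s,
    generated (range s) = [set: W]
  & forall (G : groupType) (f : I -> G), coxeter_relations m f ->
      exists phi : W -> G,
        (forall x y, phi (x * y) = phi x * phi y) /\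
        (forall i, phi (s i) = f i)].

Variables (W : groupType) (s : I -> W).
Implicit Types (u v w x t : W) (J : set I).

Definition word_of_size w n : Prop :=
  exists2 l : seq I, size l = n & w = \prod_(i <- l) s i.

(* The default value 0 is only taken on elements that are not products of
   simple reflections; there are none in a Coxeter system. *)
Definition cox_length w : nat :=
  xget 0%N [set n | word_of_size w n /\ forall k, word_of_size w k -> n <= k].

Definition reflection t : Prop := exists v i, t = v * s i * v^-1.

Definition bruhat : W -> W -> Prop :=
  clos_refl_trans W (fun v w =>
    exists2 t, reflection t & w = v * t /\ cox_length v < cox_length w).

Definition parabolic J : set W := generated (s @` J).

Definition min_rep J : set W :=
  [set w | forall u, parabolic J u -> cox_length w <= cox_length (w * u)].

Definition max_rep J : set W :=
  [set w | forall u, parabolic J u -> cox_length (w * u) <= cox_length w].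

Definition IJ J : set (W * W * W) :=
  [set q | let: (x, u, w) := q in
    [/\ max_rep J x, parabolic J u, min_rep J w & bruhat x (w * u)]].

(* None is the added least element and Some (x, u, w) is Q_{x,u,w}. *)
Definition QJ J : set (option (W * W * W)) :=
  [set q | if q is Some t then IJ J t else True].

Definition QJ_le J (p q : option (W * W * W)) : Prop :=
  match p, q with
  | None, _ => True
  | Some _, None => False
  | Some (x, u, w), Some (x', u', w') =>
      exists u1 u2,
        [/\ parabolic J u1, parabolic J u2, u1 * u2 = u
          & cox_length u = (cox_length u1 + cox_length u2)%N] /\
        [/\ bruhat (x' * u'^-1) (x * u2^-1), bruhat (x * u2^-1) (w * u1)
          & bruhat (w * u1) w']
  end.

End Coxeter.

(* Main.v *)
(* Send the triple (x, u, w) to the pair (x u^-1, w): pairs (a, w) with w of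
   minimal length in w W_J represent the cosets of the diagonal of W_J in W x W,
   and the order on triples becomes the restriction of
     (a, w) <= (a', w')  iff  a' <= a v and w v <= w' for some v in W_J,
   graded by l(w) - l(a), to the up-closed set Q of pairs with a <= w. Left
   multiplication by a simple reflection in either factor has the lifting
   property of Bruhat order, so Verma's argument applies: by induction on l(w'),
   every interval of pairs has as many elements of odd as of even rank, and
   p < q can be refined unless their ranks are consecutive. When w' = 1 the
   interval is a reversed Bruhat interval. For an interval [0, q], multiplying by
   s in the second factor pairs off all elements of Q below q but those leaving
   Q; multiplying these in both factors gives exactly the elements that s in the
   first factor fails to pair off below a q' with smaller w', so the signed count
   of the elements of Q below q does not depend on q. *)
From HB Require Import structures.
From Stdlib Require Import Relation_Operators.
Require Import Defs.
From mathcomp Require Import all_boot all_order all_algebra finmap zify.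
From mathcomp Require Import boolp classical_sets functions cardinality fsbigop.

Set Implicit Arguments.
Unset Strict Implicit.
Unset Printing Implicit Defensive.

Local Open Scope classical_set_scope.
Local Open Scope card_scope.

(** * Coxeter groups and Bruhat order *)

Section TwistedProduct.
Local Open Scope group_scope.
Variable W : groupType.

(* The semidirect product of the group of subsets of W by W. The universal
   property of the presentation of W will give a section whose first component
   sends w to its set of left inversions. *)
Definition twisted_prod : Type := ((W -> bool) * W)%type.
HB.instance Definition _ := Choice.copy twisted_prod ((W -> bool) * W)%type.

Implicit Types p q r : twisted_prod.

Definition twisted_mul p q : twisted_prod :=
  (fun x => p.1 x (+) q.1 (x ^ p.2), p.2 * q.2).
Definition twisted_inv p : twisted_prod := (fun x => p.1 (x ^ p.2^-1), p.2^-1).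
Definition twisted_one : twisted_prod := (fun=> false, 1).

Lemma twisted_mulA : associative twisted_mul.
Proof.
move=> p q r; rewrite /twisted_mul /= mulgA; congr pair; apply: funext => x.
by rewrite conjgM addbA.
Qed.

Lemma twisted_mul1p : left_id twisted_one twisted_mul.
Proof.
by case=> A w; congr pair; rewrite ?mul1g //; apply: funext => x; rewrite conjg1.
Qed.

Lemma twisted_mulp1 : right_id twisted_one twisted_mul.
Proof.
by case=> A w; congr pair; rewrite ?mulg1 //; apply: funext => x; rewrite addbF.
Qed.

Lemma twisted_mulVp : left_inverse twisted_one twisted_inv twisted_mul.
Proof.
case=> A w; congr pair; rewrite ?mulVg //=; apply: funext => x.
by rewrite addbb.
Qed.

Lemma twisted_mulpV : right_inverse twisted_one twisted_inv twisted_mul.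
Proof.
case=> A w; congr pair; rewrite ?mulgV //=; apply: funext => x.
by rewrite conjgK addbb.
Qed.

HB.instance Definition _ := isGroup.Build twisted_prod
  twisted_mulA twisted_mul1p twisted_mulp1 twisted_mulVp twisted_mulpV.

End TwistedProduct.

Section CoxeterGroup.
Local Open Scope group_scope.
Variables (I : Type) (W : groupType) (s : I -> W).
Implicit Types (u v w x y t r : W) (J : set I).
Hypothesis cox : coxeter_system s.

Lemma simpleK i : s i * s i = 1.
Proof.
case: cox => m [[m1 _ _] rel _ _].
by have := rel i i; rewrite m1 expg1.
Qed.

Lemma simpleV i : (s i)^-1 = s i.
Proof. exact/mulg1_eq/simpleK. Qed.

Lemma mul_simpleK i w : w * s i * s i = w.
Proof. by rewrite -mulgA simpleK mulg1. Qed.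

Lemma simple_mulK i w : s i * (s i * w) = w.
Proof. by rewrite mulgA simpleK mul1g. Qed.

Lemma coxeter_ind (P : W -> Prop) :
  P 1 -> (forall v w, P v -> P w -> P (v * w)) -> (forall w, P w -> P w^-1) ->
  (forall i, P (s i)) -> forall w, P w.
Proof.
move=> P1 PM PV Ps w; case: cox => m [_ _ gen _].
have : generated (range s) w by rewrite gen.
by apply; split => // _ [i _ <-].
Qed.

Lemma inversion_cocycle_exists : exists N : W -> W -> bool,
  (forall v w t, N (v * w) t = N v t (+) N w (t ^ v)) /\
  (forall i t, N (s i) t = (t == s i)).
Proof.
case: (cox) => m [_ rel gen pres].
pose f i : twisted_prod W := (fun t => t == s i, s i).
(* The first component lists, with multiplicity mod 2, the reflections met along the alternating
   word of length [k.*2]. *)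
have powf i j k : (f i * f j) ^+ k =
    (fun t => \big[addb/false]_(0 <= l < k.*2) (t == (s i * s j) ^+ l * s i),
     (s i * s j) ^+ k) :> twisted_prod W.
  elim: k => [|k IH].
    by congr pair; apply: funext => t; rewrite big_geq.
  rewrite expgSr IH; congr pair; last by rewrite expgSr.
  apply: funext => t /=; rewrite doubleS !big_nat_recr //= -addbA.
  have cK l : (s i * s j) ^+ l * s i = s i * (s i * s j) ^- l.
    elim: l => [|l IHl]; first by rewrite !expg0 invg1 mulg1 mul1g.
    have -> : (s i * s j) ^+ l.+1 * s i = (s i * s j) ^+ l * s i * (s j * s i).
      by rewrite expgSr !mulgA.
    by rewrite IHl expgS (invgM _ (_ ^+ l)) invgM !simpleV !mulgA.
  have cKK a : (t ^ (s i * s j) ^+ k == (s i * s j) ^+ a * s i) =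
           (t == (s i * s j) ^+ (a + k.*2) * s i).
    rewrite -[LHS](inj_eq (@conjg_inj _ ((s i * s j) ^- k))) /= conjgK.
    congr (_ == _); rewrite conjgE invgK -[X in _ * X]mulgA -cK !mulgA.
    by rewrite -!expgnDr; congr (_ ^+ _ * _); rewrite -addnn; lia.
  congr (_ (+) (_ (+) _)).
    by have := cKK 0%N; rewrite expg0 mul1g => ->.
  rewrite -[LHS](inj_eq (@conjg_inj _ (s i)^-1)) /= conjgK.
  have -> : s j ^ (s i)^-1 = (s i * s j) ^+ 1 * s i.
    by rewrite conjgE invgK simpleV expg1 mulgA.
  by rewrite cKK add1n.
case: (pres _ f _) => [i j|phi [phiM phis]].
  rewrite powf rel; congr pair; apply: funext => t; rewrite -addnn.
  (* For [k = m i j] the list of reflections has period [m i j], so its two halves cancel mod 2. *)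
  rewrite (big_cat_nat _ (n := m i j)) ?leq_addr //= -{2}[m i j]add0n big_addn.
  rewrite addnK; under [X in _ (+) X]eq_bigr do rewrite expgnDr rel mulg1.
  by rewrite addbb.
(* The second component of [phi] is the identity, so multiplicativity of [phi] is the cocycle
   identity for its first component. *)
have phi2 w : (phi w).2 = w.
  have phi1 : phi 1 = 1.
    by apply: (@mulgI _ (phi 1)); rewrite -phiM !mulg1.
  apply: (coxeter_ind (P := fun w => (phi w).2 = w)) => [|v z Pv Pz|v Pv|i].
  - by rewrite phi1.
  - by rewrite phiM /= Pv Pz.
  - apply: (@mulgI _ v); rewrite mulgV -{1}Pv.
    by rewrite -[_ * _]/((phi v * phi v^-1).2) -phiM mulgV phi1.
  - by rewrite phis.
exists (fun w => (phi w).1); split=> [v w t|i t]; last by rewrite phis.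
by rewrite phiM /= phi2.
Qed.

(** * Words, parabolic subgroups and length *)

Inductive word_in J : nat -> W -> Prop :=
| word_in1 : word_in J 0 1
| word_in_simple n w j : word_in J n w -> J j -> word_in J n.+1 (w * s j).

Lemma word_in_inv J n w : word_in J n w ->
  (n = 0%N /\ w = 1) \/
  exists n' w' j, [/\ n = n'.+1, w = w' * s j, word_in J n' w' & J j].
Proof. by case=> [|n' w' j ? ?]; [left | right; exists n', w', j]. Qed.

Lemma word_in_letter J j : J j -> word_in J 1 (s j).
Proof. by move=> Jj; rewrite -[s j]mul1g; constructor => //; constructor. Qed.

Lemma word_in_cat J m n v w :
  word_in J m v -> word_in J n w -> word_in J (m + n) (v * w).
Proof.
move=> Jv; elim=> [|n' w' j _ IH Jj]; first by rewrite addn0 mulg1.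
by rewrite addnS mulgA; constructor.
Qed.

Lemma word_inV J n w : word_in J n w -> word_in J n w^-1.
Proof.
elim=> [|n' w' j _ IH Jj]; first by rewrite invg1; constructor.
by rewrite invgM simpleV; apply: (@word_in_cat _ 1) => //; apply: word_in_letter.
Qed.

Lemma word_in_widen J n w : word_in J n w -> word_in [set: I] n w.
Proof. by elim=> [|n' w' j _ IH _]; constructor. Qed.

Lemma parabolicP J w : parabolic s J w <-> exists n, word_in J n w.
Proof.
split=> [H|[n]].
  apply: (H [set v | exists n, word_in J n v]); split; last first.
    by move=> _ [j Jj <-]; exists 1%N; apply: word_in_letter.
  split; first by exists 0%N; constructor.
    by move=> v z [m ?] [n ?]; exists (m + n)%N; apply: word_in_cat.
  by move=> v [n ?]; exists n; apply: word_inV.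
move=> wn H [[H1 HM HV] sH]; elim: wn => [|n' w' j _ IH Jj] //.
by apply: HM => //; apply: sH; exists j.
Qed.

Lemma parabolic1 J : parabolic s J 1.
Proof. by apply/parabolicP; exists 0%N; constructor. Qed.

Lemma parabolic_simple J j : J j -> parabolic s J (s j).
Proof. by move=> Jj; apply/parabolicP; exists 1%N; apply: word_in_letter. Qed.

Lemma parabolicM J v w :
  parabolic s J v -> parabolic s J w -> parabolic s J (v * w).
Proof.
move=> /parabolicP[m ?] /parabolicP[n ?]; apply/parabolicP.
by exists (m + n)%N; apply: word_in_cat.
Qed.

Lemma parabolicV J w : parabolic s J w -> parabolic s J w^-1.
Proof.
by move=> /parabolicP[m ?]; apply/parabolicP; exists m; apply: word_inV.
Qed.

Lemma word_of_sizeP n w : word_of_size s w n <-> word_in [set: I] n w.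
Proof.
split=> [[l <- ->]|].
  elim: l => [|i l IH]; first by rewrite big_nil; constructor.
  by rewrite big_cons; apply: (@word_in_cat _ 1) => //; apply: word_in_letter.
elim=> [|n' w' j _ [l <- ->] _]; first by exists [::]; rewrite ?big_nil.
by exists (rcons l j); rewrite ?size_rcons // -cats1 big_cat big_seq1.
Qed.

Lemma word_exists w : exists n, word_in [set: I] n w.
Proof.
apply: (coxeter_ind (P := fun w => exists n, word_in [set: I] n w)).
- by exists 0%N; constructor.
- by move=> v z [m ?] [n ?]; exists (m + n)%N; apply: word_in_cat.
- by move=> v [n ?]; exists n; apply: word_inV.
- by move=> i; exists 1%N; apply: word_in_letter.
Qed.

Local Notation len := (cox_length s).

Lemma cox_lengthP w :
  word_in [set: I] (len w) w /\ forall k, word_in [set: I] k w -> len w <= k.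
Proof.
rewrite /cox_length; case: xgetP => [n _ [/word_of_sizeP wn le_n]|none].
  by split=> // k /word_of_sizeP; apply: le_n.
have [n0 wn0] := word_exists w.
have exn : exists n, `[< word_in [set: I] n w >] by exists n0; apply/asboolP.
have [n /asboolP wn le_n] := ex_minnP exn.
case: (none n); split; first exact/word_of_sizeP.
by move=> k /word_of_sizeP wk; apply: le_n; apply/asboolP.
Qed.

Lemma cox_length_le J n w : word_in J n w -> len w <= n.
Proof. by move=> /word_in_widen; case: (cox_lengthP w) => _; apply. Qed.

Lemma cox_length1 : len 1 = 0%N.
Proof. by apply/eqP; rewrite -leqn0 (@cox_length_le set0) //; constructor. Qed.

Lemma cox_length0 w : len w = 0%N -> w = 1.
Proof.
move=> w0; have [+ _] := cox_lengthP w; rewrite w0 => /word_in_inv[[]//|].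
by case=> n [? [? []]].
Qed.

Lemma cox_lengthM v w : len (v * w) <= len v + len w.
Proof.
exact: cox_length_le (word_in_cat (cox_lengthP v).1 (cox_lengthP w).1).
Qed.

Lemma cox_lengthV w : len w^-1 = len w.
Proof.
have le z : len z^-1 <= len z.
  exact: cox_length_le (word_inV (cox_lengthP z).1).
by apply/eqP; rewrite eqn_leq le -{1}[w]invgK le.
Qed.

Lemma cox_length_simple i : len (s i) <= 1.
Proof. exact: cox_length_le (@word_in_letter setT i Logic.I). Qed.

(** * Left inversions and the deletion property *)

Section Inversions.
Variable N : W -> W -> bool.
Hypothesis NM : forall v w t, N (v * w) t = N v t (+) N w (t ^ v).
Hypothesis Ns : forall i t, N (s i) t = (t == s i).

Lemma inversion1 t : N 1 t = false.
Proof.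
by have := NM 1 1 t; rewrite mulg1 conjg1; case: (N 1 t).
Qed.

(** Some letter [s j] satisfies [t ^ w' = s j] for the product [w'] of the letters before it.
    Multiplication by [t] deletes that letter, so the rest is still a word in [J]. *)
Lemma inversion_deletion J n w t : word_in J n w -> N w t ->
  0 < n /\ word_in J n.-1 (t * w).
Proof.
elim=> [|n' w' j wn' IH Jj]; first by rewrite inversion1.
rewrite NM Ns; have [Nw _|_ /= /eqP tw] := boolP (N w' t).
  have [n0 wn] := IH Nw; split=> //=; rewrite mulgA.
  by rewrite -(prednK n0); constructor.
have tt : t * t = 1.
  by apply: (@conjg_inj _ w'); rewrite conjMg tw simpleK conj1g.
by rewrite -tw -conjgC mulgA tt mul1g.
Qed.

(** For [t = v * s i * v^-1], the contributions of [v] and [v^-1] to [N t t] cancel because [N 1 t]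
    is false, and the middle letter contributes true. *)
Lemma inversion_refl t : reflection s t -> N t t.
Proof.
case=> v [i ->]; have e : (v * s i * v^-1) ^ v = s i.
  by rewrite conjgE !mulgA mulVg mul1g -mulgA mulVg mulg1.
have := inversion1 (v * s i * v^-1); rewrite -(mulgV v) !NM Ns !conjgM e.
by rewrite eqxx conjgE simpleV mulgA mul_simpleK; case: (N v _); case: (N v^-1 _).
Qed.

Lemma reflectionK t w : reflection s t -> t * (t * w) = w.
Proof.
move=> [v [i ->]]; rewrite mulgA; have -> : v * s i * v^-1 * (v * s i * v^-1) = 1.
  by rewrite !mulgA mulgVK mul_simpleK mulgV.
by rewrite mul1g.
Qed.

Lemma inversion_length w t : reflection s t -> N w t = (len (t * w) < len w).
Proof.
have Nlt z : N z t -> len (t * z) < len z.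
  move=> Nz; have [n0 wn] := inversion_deletion (proj1 (cox_lengthP z)) Nz.
  by rewrite -(prednK n0) ltnS; apply: (cox_length_le wn).
move=> rt; have [/Nlt -> //|Nw] := boolP (N w t).
(* If [t] is not an inversion of [w], the cocycle makes it one of [t * w], and multiplying back by
   [t] shortens. *)
have : N (t * w) t.
  rewrite NM inversion_refl // conjgE.
  have -> : t^-1 * (t * t) = t by rewrite mulKg.
  by rewrite (negbTE Nw).
by move/Nlt; rewrite reflectionK //; case: ltngtP.
Qed.

End Inversions.

Lemma reflection_simple i : reflection s (s i).
Proof. by exists 1, i; rewrite mul1g invg1 mulg1. Qed.

Lemma reflectionJ t w : reflection s t -> reflection s (t ^ w).
Proof.
case=> v [i ->]; exists (w^-1 * v), i.
by rewrite conjgE invgM invgK !mulgA.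
Qed.

(* The cocycle identity for left inversion sets, phrased with lengths. *)
Lemma inversionM v w t : reflection s t ->
  (len (t * (v * w)) < len (v * w)) =
  (len (t * v) < len v) (+) (len (t ^ v * w) < len w).
Proof.
have [N [NM Ns]] := inversion_cocycle_exists.
by move=> rt; rewrite -!(inversion_length NM Ns) //; apply: reflectionJ.
Qed.

Lemma deletion J n w t : reflection s t -> word_in J n w ->
  len (t * w) < len w -> 0 < n /\ word_in J n.-1 (t * w).
Proof.
have [N [NM Ns]] := inversion_cocycle_exists.
move=> rt wn; rewrite -(inversion_length NM Ns) //.
exact: inversion_deletion.
Qed.

Lemma neq_len_reflection w t : reflection s t -> len (t * w) != len w.
Proof.
have [N [NM Ns]] := inversion_cocycle_exists.
move=> rt; have := inversion_length NM Ns w rt.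
have := inversion_length NM Ns (t * w) rt.
rewrite reflectionK // NM inversion_refl // conjgE.
have -> : t^-1 * (t * t) = t by rewrite mulKg.
by case: ltngtP; case: (N w t).
Qed.

Lemma len_simpleL i w : len (s i * w) = (len w).+1 \/ len w = (len (s i * w)).+1.
Proof.
have := neq_len_reflection w (reflection_simple i).
have := cox_lengthM (s i) w; have := cox_length_simple i.
have := cox_lengthM (s i) (s i * w); rewrite simple_mulK => ? ? ? ?. lia.
Qed.

Lemma mulVsimple x i : (x * s i)^-1 = s i * x^-1.
Proof. by rewrite invgM simpleV. Qed.

Lemma len_mulVsimple x i : len (s i * x^-1) = len (x * s i).
Proof. by rewrite -mulVsimple cox_lengthV. Qed.

Lemma len_simpleR w i : len (w * s i) = (len w).+1 \/ len w = (len (w * s i)).+1.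
Proof.
by have := len_simpleL i w^-1; rewrite len_mulVsimple cox_lengthV.
Qed.

Lemma len_simple_gt0 i : len (s i) = 1%N.
Proof.
by have := len_simpleL i 1; rewrite mulg1 cox_length1; case.
Qed.

(** * Bruhat order and its lifting property *)

Local Notation "x <=B y" := (bruhat s x y) (at level 70, no associativity).

Lemma bruhat_refl x : x <=B x. Proof. exact: rt_refl. Qed.

Lemma bruhat_trans y x z : x <=B y -> y <=B z -> x <=B z.
Proof. exact: rt_trans. Qed.

Lemma reflectionV t : reflection s t -> t^-1 = t.
Proof. by case=> v [i ->]; rewrite !invgM invgK simpleV !mulgA. Qed.

Lemma bruhat_step x t : reflection s t -> len x < len (t * x) -> x <=B t * x.
Proof.
move=> rt lt; apply: rt_step; exists (t ^ x); first exact: reflectionJ.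
by rewrite -conjgC.
Qed.

(** [bruhat] multiplies by reflections on the right; [x * t = t ^ x^-1 * x] turns every step into a
    left multiplication. *)
Lemma bruhat_indL (R : W -> W -> Prop) :
  (forall x, R x x) ->
  (forall x t, reflection s t -> len x < len (t * x) -> R x (t * x)) ->
  (forall x y z, x <=B y -> y <=B z -> R x y -> R y z -> R x z) ->
  forall x y, x <=B y -> R x y.
Proof.
move=> R1 Rs Rt x y; elim=> {x y} [x y [t rt [-> lt]]|x|x y z xy Rxy yz Ryz] //.
- have e : x * t = t ^ x^-1 * x by rewrite -conjgCV.
  by rewrite e; apply: Rs; rewrite -?e //; apply: reflectionJ.
- exact: Rt xy yz Rxy Ryz.
Qed.

Lemma bruhat_length x y : x <=B y -> len x <= len y ?= iff (x == y).
Proof.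
elim/bruhat_indL: x y / => [x|x t _ lt|x y z _ _]; first by split; rewrite ?eqxx.
  apply/leqifP; case: eqP => [e|//].
  by rewrite -e ltnn in lt.
move=> [xy exy] [yz eyz]; split; first exact: leq_trans xy yz.
apply/idP/idP => [/eqP e|/eqP -> //].
have /eqP e1 : len x == len y by rewrite eqn_leq xy e yz.
have /eqP e2 : len y == len z by rewrite -e1 e.
by move: exy eyz; rewrite e1 e2 eqxx => /esym/eqP -> /esym ->.
Qed.

Lemma bruhat_len x y : x <=B y -> len x <= len y.
Proof. by case/bruhat_length. Qed.

Lemma bruhat_len_eq x y : x <=B y -> len y <= len x -> x = y.
Proof.
by move=> /bruhat_length[xy e] yx; apply/eqP; rewrite -e eqn_leq xy.
Qed.

Lemma bruhat_anti x y : x <=B y -> y <=B x -> x = y.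
Proof. by move=> xy /bruhat_len; apply: bruhat_len_eq. Qed.

Lemma bruhatV x y : x <=B y -> x^-1 <=B y^-1.
Proof.
elim/bruhat_indL: x y / => [x|x t rt lt|x y z _ _]; first exact: bruhat_refl.
  apply: rt_step; exists t => //; split; last by rewrite !cox_lengthV.
  by rewrite invgM (reflectionV rt).
exact: bruhat_trans.
Qed.

Lemma bruhatV_iff x y : x^-1 <=B y^-1 -> x <=B y.
Proof. by move/bruhatV; rewrite !invgK. Qed.

Lemma bruhat_simpleL i x : len x < len (s i * x) -> x <=B s i * x.
Proof. exact/bruhat_step/reflection_simple. Qed.

Lemma bruhat_simpleL_dec i x : len (s i * x) < len x -> s i * x <=B x.
Proof.
by move=> lt; rewrite -{2}[x](simple_mulK i); apply: bruhat_simpleL; rewrite simple_mulK.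
Qed.

(** By the cocycle identity, for [t] other than [s i], the reflection [t ^ s i] is an inversion of
    [s i * x] exactly when [t] is one of [x]. *)
Lemma bruhat_simple_step i x t : reflection s t -> len x < len (t * x) ->
  s i * x = t * x \/ s i * x <=B s i * (t * x).
Proof.
move=> rt lt; have [->|ti] := eqVneq t (s i); [by left|right].
have -> : s i * (t * x) = t ^ s i * (s i * x).
  by rewrite conjgE simpleV !mulgA mul_simpleK.
apply: bruhat_step; first exact: reflectionJ.
have rts := reflectionJ (s i) rt.
rewrite ltn_neqAle leqNgt eq_sym neq_len_reflection //= inversionM //.
have -> : (t ^ s i) ^ s i = t.
  by rewrite -conjgM simpleK conjg1.
rewrite (ltnNge (len (t * x))) (ltnW lt) addbF -leqNgt.
have [N [NM Ns]] := inversion_cocycle_exists.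
rewrite leqNgt -(inversion_length NM Ns) // Ns.
apply: contra_neqN ti => /eqP e; apply: (@conjg_inj _ (s i)).
by rewrite e conjgE mulKg.
Qed.

(** The lifting property without descent hypotheses: each disjunction composes along chains, so
    single steps suffice. *)
Lemma bruhat_simple i x y : x <=B y ->
  (s i * x <=B s i * y \/ s i * x <=B y) /\
  (s i * x <=B s i * y \/ x <=B s i * y).
Proof.
elim/bruhat_indL: x y / => [x|x t rt lt|x y z xy yz [xy1 xy2] [yz1 yz2]].
- by split; left; apply: bruhat_refl.
- case: (bruhat_simple_step i rt lt) => [e|]; last by split; left.
  by rewrite -e simple_mulK; split; right; apply: bruhat_refl.
split.
  case: xy1 => xy1; last by right; apply: bruhat_trans yz.
  by case: yz1 => yz1; [left|right]; apply: bruhat_trans yz1.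
case: yz2 => yz2; last by right; apply: bruhat_trans yz2.
by case: xy2 => xy2; [left|right]; apply: bruhat_trans yz2.
Qed.

Lemma bruhat_liftL i x y : len (s i * y) < len y -> x <=B y -> s i * x <=B y.
Proof.
move=> lt /(bruhat_simple i)[[H|//] _].
by apply: bruhat_trans H _; apply: bruhat_simpleL_dec.
Qed.

Lemma bruhat_lift2L i x y : len (s i * x) < len x -> len (s i * y) < len y ->
  x <=B y -> s i * x <=B s i * y.
Proof.
move=> lx ly /(bruhat_simple i)[_ [//|]]; apply: bruhat_trans.
exact: bruhat_simpleL_dec.
Qed.

Lemma bruhat_liftL_up i x y : len y < len (s i * y) -> x <=B y ->
  s i * x <=B s i * y.
Proof.
move=> lt xy; apply: bruhat_liftL; first by rewrite simple_mulK.
by apply: bruhat_trans xy _; apply: bruhat_simpleL.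
Qed.

Lemma bruhat_liftL_min i x y : len x < len (s i * x) -> len (s i * y) < len y ->
  x <=B y -> x <=B s i * y.
Proof.
move=> lx ly xy; rewrite -[x](simple_mulK i); apply: bruhat_lift2L => //.
  by rewrite simple_mulK.
exact: bruhat_liftL.
Qed.

Lemma bruhat_simpleR i x : len x < len (x * s i) -> x <=B x * s i.
Proof.
move=> lx; apply: bruhatV_iff; rewrite mulVsimple; apply: bruhat_simpleL.
by rewrite len_mulVsimple cox_lengthV.
Qed.

Lemma bruhat_simpleR_dec i x : len (x * s i) < len x -> x * s i <=B x.
Proof.
move=> lx; apply: bruhatV_iff; rewrite mulVsimple; apply: bruhat_simpleL_dec.
by rewrite len_mulVsimple cox_lengthV.
Qed.

Lemma bruhat_liftR i x y : len (y * s i) < len y -> x <=B y -> x * s i <=B y.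
Proof.
move=> ly xy; apply: bruhatV_iff; rewrite mulVsimple.
by apply: bruhat_liftL; rewrite ?len_mulVsimple ?cox_lengthV //; apply: bruhatV.
Qed.

Lemma bruhat_lift2R i x y : len (x * s i) < len x -> len (y * s i) < len y ->
  x <=B y -> x * s i <=B y * s i.
Proof.
move=> lx ly xy; apply: bruhatV_iff; rewrite !mulVsimple.
by apply: bruhat_lift2L; rewrite ?len_mulVsimple ?cox_lengthV //; apply: bruhatV.
Qed.

Lemma bruhat_liftR_up i x y : len y < len (y * s i) -> x <=B y ->
  x * s i <=B y * s i.
Proof.
move=> lt xy; apply: bruhat_liftR; first by rewrite mul_simpleK.
by apply: bruhat_trans xy _; apply: bruhat_simpleR.
Qed.

Lemma bruhat_liftR_min i x y : len x < len (x * s i) -> len (y * s i) < len y ->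
  x <=B y -> x <=B y * s i.
Proof.
move=> lx ly xy; rewrite -[x](mul_simpleK i); apply: bruhat_lift2R => //.
  by rewrite mul_simpleK.
exact: bruhat_liftR.
Qed.

Lemma bruhat_1 y : 1 <=B y.
Proof.
have [+ _] := cox_lengthP y; elim=> [|n w j _ IH _]; first exact: bruhat_refl.
have [lt|] := ltnP (len w) (len (w * s j)).
  by apply: bruhat_trans IH _; apply: bruhat_simpleR.
case: (len_simpleR w j) => e le; first by lia.
by apply: bruhat_liftR_min; rewrite ?mul1g ?cox_length1 ?len_simple_gt0 // e.
Qed.

(** * Parabolic subgroups and coset representatives *)

Lemma reflectionVJ t w : reflection s t -> reflection s (w * t * w^-1).
Proof. by move=> rt; rewrite -{1}[w]invgK -mulgA -conjgE; apply: reflectionJ. Qed.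

Lemma inversionMR v w t : reflection s t ->
  (len (v * w * t) < len (v * w)) =
  (len (w * t) < len w) (+) (len (v * (w * t * w^-1)) < len v).
Proof.
move=> rt; have rV u r : reflection s r -> len (u * r) = len (r * u^-1).
  by move=> rr; rewrite -(cox_lengthV (u * r)) invgM (reflectionV rr).
rewrite (rV (v * w)) // (rV w) // (rV v (w * t * w^-1)); last exact: reflectionVJ.
rewrite -(cox_lengthV (v * w)) invgM inversionM // !cox_lengthV.
by rewrite conjgE invgK mulgA.
Qed.

(** When appending a letter shortens the element, deletion removes a letter of the word already
    built, so reducing never leaves [J]. *)
Lemma parabolic_word J w : parabolic s J w -> word_in J (len w) w.
Proof.
move=> /parabolicP[n]; elim=> [|n' v j _ IH Jj].
  by rewrite cox_length1; constructor.
have [e|e] := len_simpleR v j; first by rewrite e; constructor.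
have rt := reflectionVJ v (reflection_simple j).
have vj : v * s j * v^-1 * v = v * s j by rewrite mulgVK.
by have := deletion rt IH; rewrite vj e /= => -[|].
Qed.

Lemma parabolic_ind J (P : W -> Prop) : P 1 ->
  (forall v j, parabolic s J v -> J j -> len (v * s j) = (len v).+1 -> P v ->
     P (v * s j)) ->
  forall v, parabolic s J v -> P v.
Proof.
move=> P1 PS v Jv; have [n le_n] := ubnP (len v).
elim: n => // n IH in v Jv le_n *.
have /word_in_inv[[_ ->//]|[n' [v' [j [e ev wv' Jj]]]]] := parabolic_word Jv.
have Jv' : parabolic s J v' by apply/parabolicP; exists n'.
have le_v' := cox_length_le wv'.
have ev' : len (v' * s j) = (len v').+1.
  by rewrite -ev; case: (len_simpleR v' j); rewrite -ev; lia.
by rewrite ev; apply: PS => //; apply: IH => //; rewrite -ev in ev'; lia.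
Qed.

(** The reflection [v * s j * v^-1] lies in [W_J], so it never shortens [w] from the right, and the
    cocycle identity leaves only the term of [v]. *)
Lemma min_rep_simple J w v j : min_rep s J w -> parabolic s J v -> J j ->
  (len (w * v * s j) < len (w * v)) = (len (v * s j) < len v).
Proof.
move=> mw Jv Jj; rewrite inversionMR; last exact: reflection_simple.
have Jt : parabolic s J (v * s j * v^-1).
  by apply: parabolicM (parabolicV Jv); apply: parabolicM (parabolic_simple Jj).
by rewrite [X in _ (+) X]ltnNge (mw _ Jt) addbF.
Qed.

(** Here the reflection [v * s j * v^-1] always shortens [w], which negates the term of [v]. *)
Lemma max_rep_simple J w v j : max_rep s J w -> parabolic s J v -> J j ->
  (len (w * v * s j) < len (w * v)) = ~~ (len (v * s j) < len v).
Proof.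
move=> mw Jv Jj; have rj := reflection_simple j; rewrite inversionMR //.
have rt := reflectionVJ v rj; set t := v * s j * v^-1 in rt *.
have Jt : parabolic s J t.
  by apply: parabolicM (parabolicV Jv); apply: parabolicM (parabolic_simple Jj).
have wt : len (w * t) != len w.
  have := neq_len_reflection w^-1 rt.
  by rewrite -{1}(reflectionV rt) -invgM !cox_lengthV.
by rewrite [X in _ (+) X]ltn_neqAle wt (mw _ Jt) addbT.
Qed.

Lemma min_rep_len J w v : min_rep s J w -> parabolic s J v ->
  len (w * v) = (len w + len v)%N.
Proof.
move=> mw; elim/parabolic_ind: v / => [|v j Jv Jj e IH].
  by rewrite mulg1 cox_length1 addn0.
have := min_rep_simple mw Jv Jj; rewrite e [X in _ = X]ltnNge leqnSn mulgA.
by case: (len_simpleR (w * v) j) => ->; rewrite ?ltnSn ?IH ?addnS.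
Qed.

Lemma max_rep_len J w v : max_rep s J w -> parabolic s J v ->
  (len (w * v) + len v)%N = len w.
Proof.
move=> mw; elim/parabolic_ind: v / => [|v j Jv Jj e IH].
  by rewrite mulg1 cox_length1 addn0.
have := max_rep_simple mw Jv Jj; rewrite e -leqNgt leqnSn mulgA -IH.
by case: (len_simpleR (w * v) j) => ->; rewrite ?ltnSn ?addnS ?addSn // ltnNge leqnSn.
Qed.

Lemma min_rep_exists J w :
  exists v u, [/\ min_rep s J v, parabolic s J u & w = v * u].
Proof.
pose P n := `[< exists2 u, parabolic s J u & len (w * u) = n >].
have exP : exists n, P n.
  by exists (len w); apply/asboolP; exists 1; rewrite ?mulg1 //; apply: parabolic1.
have [n /asboolP[u Ju un] le_n] := ex_minnP exP.
exists (w * u), u^-1; split; last by rewrite mulgK.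
  move=> u' Ju'; rewrite un; apply: le_n; apply/asboolP; exists (u * u').
    exact: parabolicM.
  by rewrite mulgA.
exact: parabolicV.
Qed.

Lemma max_rep_exists J w : finite_set (parabolic s J) ->
  exists v u, [/\ max_rep s J v, parabolic s J u & w = v * u].
Proof.
move=> /finite_seqP[l Jl].
pose P n := `[< exists2 u, parabolic s J u & len (w * u) = n >].
have exP : exists n, P n.
  by exists (len w); apply/asboolP; exists 1; rewrite ?mulg1 //; apply: parabolic1.
(* Finiteness of [W_J] bounds the lengths in the coset. *)
have bP n : P n -> n <= \max_(u <- l) len (w * u).
  move=> /asboolP[u + <-]; rewrite Jl => /= ul.
  by apply: (leq_bigmax_seq (F := fun u => len (w * u))).
have [n /asboolP[u Ju un] le_n] := ex_maxnP exP bP.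
exists (w * u), u^-1; split; last by rewrite mulgK.
  move=> u' Ju'; rewrite un; apply: le_n; apply/asboolP; exists (u * u').
    exact: parabolicM.
  by rewrite mulgA.
exact: parabolicV.
Qed.

Lemma min_repP J w : (forall j, J j -> len w < len (w * s j)) -> min_rep s J w.
Proof.
move=> H; have [v [u [mv Ju e]]] := min_rep_exists J w.
have /word_in_inv[[_ eu]|[n [u' [j [en eu wu' Jj]]]]] := parabolic_word Ju.
  by rewrite e eu mulg1.
have Ju' : parabolic s J u' by apply/parabolicP; exists n.
have := H j Jj; have le_n := cox_length_le wu'.
rewrite e (min_rep_len mv Ju) eu -!mulgA simpleK mulg1 (min_rep_len mv Ju') -eu.
by lia.
Qed.

Lemma min_rep_simple_lt J w j : min_rep s J w -> J j -> len w < len (w * s j).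
Proof.
move=> mw Jj; rewrite (min_rep_len mw) ?len_simple_gt0 ?addn1 //.
exact: parabolic_simple.
Qed.

Lemma min_rep_inj J w w' v : min_rep s J w -> min_rep s J w' ->
  parabolic s J v -> w * v = w' -> v = 1.
Proof.
move=> mw mw' Jv e; have := min_rep_len mw Jv.
have := min_rep_len mw' (parabolicV Jv).
rewrite -e mulgK cox_lengthV => e1 e2; apply: cox_length0; lia.
Qed.

Lemma max_rep_inj J w w' v : max_rep s J w -> max_rep s J w' ->
  parabolic s J v -> w * v = w' -> v = 1.
Proof.
move=> mw mw' Jv e; have := max_rep_len mw Jv.
have := max_rep_len mw' (parabolicV Jv).
rewrite -e mulgK cox_lengthV => e1 e2; apply: cox_length0; lia.
Qed.

(** Deodhar's lemma. If [s j] lengthens [w] but not [s i * w], then [bruhat_simple_step] for the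
    reflection [w * s j * w^-1] leaves only [s i * w = w * s j]. *)
Lemma min_rep_mulL J i w : min_rep s J w ->
  min_rep s J (s i * w) \/ exists2 j, J j & s i * w = w * s j.
Proof.
move=> mw; case: (pselect (forall j, J j -> len (s i * w) < len (s i * w * s j))).
  by move=> /min_repP; left.
move=> /existsNP[j /not_implyP[Jj /negP]]; rewrite -leqNgt => le; right.
exists j => //; have lt := min_rep_simple_lt mw Jj.
have := @bruhat_simple_step i w _ (reflectionVJ w (reflection_simple j)).
rewrite mulgVK => /(_ lt)[//|/bruhat_length[le' e]].
have : s i * w == s i * (w * s j) by rewrite -e eqn_leq le' mulgA le.
move=> /eqP/mulgI e'; by rewrite -e' ltnn in lt.
Qed.

Lemma min_rep_descent J i w : min_rep s J w -> len (s i * w) < len w ->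
  min_rep s J (s i * w).
Proof.
move=> mw lt; case: (min_rep_mulL i mw) => // -[j Jj e].
by have := min_rep_simple_lt mw Jj; rewrite -e; lia.
Qed.

Lemma bruhat_parabolic_mono J a w v : min_rep s J w -> parabolic s J v ->
  a <=B w -> a * v <=B w * v.
Proof.
move=> mw + aw; elim/parabolic_ind: v / => [|v j Jv Jj e IH].
  by rewrite !mulg1.
rewrite !mulgA; apply: bruhat_liftR_up => //.
rewrite -mulgA !(min_rep_len mw) ?e ?ltn_add2l //.
by apply: parabolicM => //; apply: parabolic_simple.
Qed.

Lemma bruhat_min_le J w v : min_rep s J w -> parabolic s J v -> w <=B w * v.
Proof.
move=> mw; elim/parabolic_ind: v / => [|v j Jv Jj e IH].
  by rewrite mulg1; apply: bruhat_refl.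
apply: bruhat_trans IH _; rewrite mulgA; apply: bruhat_simpleR.
rewrite -mulgA !(min_rep_len mw) ?e ?ltn_add2l //.
by apply: parabolicM => //; apply: parabolic_simple.
Qed.

(** * Finite lower sets and the greatest element *)

Lemma bruhat_finite y : finite_set [set x | x <=B y].
Proof.
have [+ _] := cox_lengthP y; elim=> [|n w j _ IH _].
  apply: (@sub_finite_set _ _ [set 1]) => // x /= x1.
  by apply: bruhat_len_eq x1 _; rewrite cox_length1.
have [lt|ge] := ltnP (len w) (len (w * s j)); last first.
  apply: sub_finite_set IH => x /= xw; apply: bruhat_trans xw _.
  by apply: bruhat_simpleR_dec; case: (len_simpleR w j) ge => ->; lia.
(* Lifting puts [x] or [x * s j] below [w], according to whether [s j] lengthens or shortens [x]. *)
apply: (@sub_finite_set _ _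
  ([set x | x <=B w] `|` (fun x => x * s j) @` [set x | x <=B w])).
  move=> x /= xw; have ws : len (w * s j * s j) < len (w * s j) by rewrite mul_simpleK.
  case: (len_simpleR x j) => e; [left|right].
    by rewrite -[w](mul_simpleK j); apply: bruhat_liftR_min => //; rewrite e.
  exists (x * s j); last by rewrite mul_simpleK.
  by rewrite -[w](mul_simpleK j); apply: bruhat_lift2R => //; rewrite [X in _ < X]e.
by rewrite finite_setU; split => //; apply: finite_image.
Qed.

(** An element of maximal length has every simple reflection as a left descent, so adding letters on
    the left never leaves its lower set. *)
Lemma bruhat_greatest : finite_set [set: W] -> exists w0, forall y, y <=B w0.
Proof.
move=> /finite_seqP[l lE]; have inl w : w \in l.
  by have : [set: W] w by []; rewrite lE.
pose P n := `[< exists w, len w = n >].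
have exP : exists n, P n by exists (len 1); apply/asboolP; exists 1.
have bP n : P n -> n <= \max_(u <- l) len u.
  by move=> /asboolP[w <-]; apply: (leq_bigmax_seq (F := len)).
have [n /asboolP[w0 <-] max_w0] := ex_maxnP exP bP; exists w0 => y.
have [+ _] := cox_lengthP y^-1; rewrite -[y in y <=B _]invgK; move: y^-1 => {}y.
elim=> [|k w j _ IH _]; first by rewrite invg1; apply: bruhat_1.
rewrite mulVsimple; apply: bruhat_liftL => //.
case: (len_simpleL j w0) => [e|-> //].
have /max_w0 : P (len (s j * w0)) by apply/asboolP; exists (s j * w0).
by rewrite e ltnn.
Qed.
End CoxeterGroup.

(** * Signed counts and ranked posets *)

Section SignedCount.
Import GRing.Theory.
Local Open Scope ring_scope.

Implicit Types P Q : choiceType.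

(** A finitely supported sum: no term vanishes, so an infinite [S] gets the default value 0. *)
Definition signed_count P (e : P -> bool) (S : set P) : int :=
  \sum_(x \in S) ((-1) ^+ e x : int).

Lemma signed_count0 P e : @signed_count P e set0 = 0.
Proof. exact: fsbig_set0. Qed.

Lemma signed_count1 P e (x : P) : signed_count e [set x] = (-1) ^+ e x.
Proof. exact: fsbig_set1. Qed.

Lemma signed_countU P e (S T : set P) :
  finite_set S -> finite_set T -> S `&` T `<=` set0 ->
  signed_count e (S `|` T) = signed_count e S + signed_count e T.
Proof. by move=> *; rewrite /signed_count fsbigU0. Qed.

Lemma signed_count_bij P Q (f : Q -> P) (S : set Q) (T : set P)
    (e : P -> bool) (e' : Q -> bool) (b : bool) : set_bij S T f ->
  (forall x, S x -> e (f x) = e' x (+) b) ->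
  signed_count e T = (-1) ^+ b * signed_count e' S.
Proof.
move=> bij ef; rewrite /signed_count (reindex_fsbig f S T) // mulr_fsumr.
by apply: eq_fsbigr => x /set_mem Sx; rewrite ef // signr_addb mulrC.
Qed.

Lemma signed_count_involution P e (S : set P) (f : P -> P) :
  (forall x, S x -> S (f x)) -> (forall x, S x -> f (f x) = x) ->
  (forall x, S x -> e (f x) = ~~ e x) -> signed_count e S = 0.
Proof.
move=> Sf fK ef; have : signed_count e S = - signed_count e S.
  rewrite {1}(@signed_count_bij _ _ f S S e e true) ?mulN1r //; last first.
    by move=> x Sx; rewrite ef // addbT.
  split=> [x|x y /set_mem Sx /set_mem Sy fxy|x Sx]; first exact: Sf.
    by rewrite -[x]fK // fxy fK.
  by exists (f x); [apply: Sf|apply: fK].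
lia.
Qed.

Lemma signed_count_card P e (S : set P) : finite_set S -> signed_count e S = 0 ->
  [set x | S x /\ e x] #= [set x | S x /\ ~~ e x].
Proof.
move=> finS; have finI (T : set P) : finite_set (S `&` T) by apply: finite_setIl.
rewrite /signed_count (fsbigID [set x | e x]) // !fsbig_finite // => eq0.
apply/fcard_eq; [exact: finI|exact: finI|].
have : - (#|` fset_set (S `&` [set x | e x])|%:R : int)
   + #|` fset_set (S `&` ~` [set x | e x])|%:R = 0.
  rewrite -[RHS]eq0; congr (_ + _); rewrite -!sum1_size natr_sum.
    rewrite -sumrN !big_seq; apply: eq_bigr => x; rewrite in_fset_set //.
    by move=> /set_mem[_ /= ->].
  rewrite !big_seq; apply: eq_bigr => x; rewrite in_fset_set //.
  by move=> /set_mem[_ /= /negP/negbTE ->].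
have -> : S `&` ~` [set x | e x] = [set x | S x /\ ~~ e x].
  by apply/seteqP; split=> x /= [Sx /negP].
rewrite -[[set x | S x /\ e x]]/(S `&` [set x | e x]).
lia.
Qed.

End SignedCount.

(** * Maximal chains and ranks *)

Lemma maximal_chain_exists (P : Type) (le : P -> P -> Prop) (A : set P) :
  exists C, maximal_chain le A C.
Proof.
pose chain C := C `<=` A /\ total_on C le.
have [F chF totF|C [[CA totC] maxC]] := @Zorn_bigcup _ chain.
  split=> [x [C FC Cx]|x y [C FC Cx] [D FD Dy]]; first exact: (chF C FC).1.
  case: (totF C D FC FD) => sub.
    by apply: (chF D FD).2 => //; apply: sub.
  by apply: (chF C FC).2 => //; apply: sub.
exists C; split=> // D DA totD CD; apply/esym/seteqP; split=> //.
by apply: contrapT => nDC; apply: (maxC D).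
Qed.

Section RankedPosets.
Variables (P : choiceType) (le : P -> P -> Prop) (A : set P) (rk : P -> nat).
Hypothesis poA : partial_order_on le A.
Hypothesis rk_lt : forall x y, A x -> A y -> le x y -> x <> y -> rk x < rk y.
Hypothesis rk_gap : forall x y, A x -> A y -> le x y -> (rk x).+1 < rk y ->
  exists z, [/\ A z, le x z, le z y, z <> x & z <> y].

Lemma interval_in_nested a b c d : A a -> A b ->
  interval_in le A a b c -> interval_in le A a b d ->
  interval_in le (interval_in le A a b) c d = interval_in le A c d.
Proof.
case: poA => _ _ tr Aa Ab [Ac ac cb] [Ad ad db].
apply/seteqP; split=> x [Ax cx xd]; first by case: Ax.
by split=> //; split=> //; [apply: (tr a c x)|apply: (tr x d b)].
Qed.

Lemma chain_rank_lt C x y : C `<=` A -> total_on C le -> C x -> C y ->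
  rk x <= rk y -> le x y.
Proof.
move=> CA totC Cx Cy xy; case: (totC x y Cx Cy) => // yx.
have [->|/eqP ne] := eqVneq x y; first by case: (totC y y Cy Cy).
have := rk_lt (CA _ Cy) (CA _ Cx) yx; rewrite ltnNge xy => H.
by have := H (fun e => ne (esym e)).
Qed.

Lemma maximal_chain_rank a b C k : A a -> A b -> le a b ->
  maximal_chain le (interval_in le A a b) C -> rk a <= k <= rk b ->
  exists2 x, C x & rk x = k.
Proof.
case: (poA) => rf anti tr Aa Ab ab [CI totC maxC].
have CA : C `<=` A by move=> x /CI[].
have maxC1 z : interval_in le A a b z -> (forall x, C x -> le x z \/ le z x) -> C z.
  move=> Iz cmp; have <- : C `|` [set z] = C; last by right.
  apply: maxC; last by move=> x Cx; left.
    by move=> x [/CI//|->].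
  move=> x y [Cx|->] [Cy|->]; [exact: totC|exact: cmp|exact/or_comm/cmp|].
  by left; apply: rf; case: Iz.
have Ca : C a.
  by apply: maxC1 => [|x /CI[_ ax _]]; [split=> //; apply: rf|right].
have Cb : C b.
  by apply: maxC1 => [|x /CI[_ _ xb]]; [split=> //; apply: rf|left].
move=> /andP[]; elim: k => [|k IH] ak kb.
  by exists a => //; apply/eqP; rewrite -leqn0.
have [ek|ne] := eqVneq (rk a) k.+1; first by exists a.
have [|x Cx xk] := IH _ (ltnW kb); first lia.
(* [y] will have the least rank above [k] in the chain. If it skipped [k.+1], the [z] of [rk_gap]
   would be comparable with all of [C], hence in [C] by maximality, with a smaller rank above
   [k]. *)
pose Q n := `[< exists2 y, C y & (rk y = n /\ k < n) >].
have exQ : exists n, Q n by exists (rk b); apply/asboolP; exists b.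
have [n /asboolP[y Cy [yn kn]] min_n] := ex_minnP exQ.
have [e|nk] := eqVneq n k.+1; first by exists y; rewrite ?yn.
have xy : le x y by apply: (chain_rank_lt CA totC) => //; lia.
have [|z [Az xz zy zx zy']] := rk_gap (CA _ Cx) (CA _ Cy) xy; first lia.
have Cz : C z.
  apply: maxC1 => [|c Cc].
    have [_ ax _] := CI _ Cx; have [_ _ yb] := CI _ Cy; have Ax := CA _ Cx.
    by have Ay := CA _ Cy; split=> //; [apply: (tr a x z)|apply: (tr z y b)].
  have Ac := CA _ Cc; have [ck|kc] := leqP (rk c) k; [left|right].
    apply: (tr c x z) => //; first exact: CA.
    by apply: (chain_rank_lt CA totC) => //; rewrite xk.
  apply: (tr z y c) => //; first exact: CA.
  apply: (chain_rank_lt CA totC) => //; rewrite yn; apply: min_n.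
  by apply/asboolP; exists c.
have lt1 : rk x < rk z by apply: rk_lt => //; [apply: CA|move=> e; apply: zx].
have lt2 : rk z < rk y by apply: rk_lt => //; apply: CA.
have : n <= rk z by apply: min_n; apply/asboolP; exists z => //; split=> //; lia.
by lia.
Qed.

Lemma maximal_chain_length a b C : A a -> A b -> le a b ->
  maximal_chain le (interval_in le A a b) C -> chain_length C (rk b - rk a).
Proof.
move=> Aa Ab ab mC; have [CI totC _] := mC; have [rf anti tr] := poA.
have CA : C `<=` A by move=> x /CI[].
have rk_le x y : A x -> A y -> le x y -> rk x <= rk y.
  move=> Ax Ay xy; have [->//|/eqP ne] := eqVneq x y.
  exact/ltnW/rk_lt.
have rkC x : C x -> rk a <= rk x <= rk b.
  by move=> /[dup] Cx /CI[Ax ax xb]; rewrite !rk_le.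
apply/card_set_bijP; exists (fun x => rk x - rk a)%N.
split=> [x /rkC|x y /set_mem Cx /set_mem Cy|n /= nb]; rewrite /=; first lia.
    have := rkC _ Cx; have := rkC _ Cy => ry rx e.
    have exy : rk x = rk y by lia.
    by apply: anti; [apply: CA..|apply: (chain_rank_lt CA totC)|
      apply: (chain_rank_lt CA totC)]; rewrite ?exy.
  have [|x Cx ex] := maximal_chain_rank (k := (rk a + n)%N) Aa Ab ab mC.
    have := rk_le _ _ Aa Ab ab; lia.
  by exists x => //; rewrite ex; lia.
Qed.

Lemma chain_length_inj (C : set P) m n :
  chain_length C m -> chain_length C n -> m = n.
Proof.
rewrite /chain_length => /card_esym mC Cn.
by have /card_eq_II[] := card_eq_trans mC Cn.
Qed.

(** Inside an interval ranks are measured from its bottom [a]; the existence of a maximal chain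
    makes the value unique. *)
Lemma has_rankE a b x n : A a -> A b -> interval_in le A a b x ->
  has_rank le (interval_in le A a b) x n <-> n = (rk x - rk a)%N.
Proof.
case: (poA) => rf anti tr Aa Ab Ix; have [Ax ax xb] := Ix.
have Ia : interval_in le A a b a.
  by split=> //; [apply: rf|apply: (tr a x b)].
have E := interval_in_nested Aa Ab Ia Ix.
have leastE bot : least_in le (interval_in le A a b) bot <-> bot = a.
  split=> [[[Abot abot _] /(_ a Ia) bota]|->]; first exact: anti.
  by split=> // y [].
have [C mC] := maximal_chain_exists le (interval_in le A a x).
split=> [[bot /leastE-> [_]]|->].
  rewrite E => /(_ C mC) /chain_length_inj; apply; exact: maximal_chain_length.
exists a; first exact/leastE.
by rewrite E; split=> [|D]; [exists C|apply: maximal_chain_length].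
Qed.

Hypothesis intervals_finite :
  forall a b, A a -> A b -> finite_set (interval_in le A a b).
Hypothesis intervals_balanced :
  forall a b, A a -> A b -> le a b -> a <> b ->
  signed_count (odd \o rk) (interval_in le A a b) = 0%R.

Lemma ranked_poset_eulerian a b : A a -> A b -> le a b ->
  eulerian le (interval_in le A a b).
Proof.
case: (poA) => rf anti tr Aa Ab ab.
have IA : interval_in le A a b `<=` A by move=> ? [].
split.
- split=> [x /IA|x y /IA ? /IA ?|x y z /IA ? /IA ? /IA ?]; [exact: rf|exact: anti|].
  exact: tr.
- exact: intervals_finite.
- by exists a; split=> [|x []//]; split=> //; apply: rf.
- by exists b; split=> [|x []//]; split=> //; apply: rf.
split=> [|c d Ic Id cd cNd].
  by exists (rk b - rk a)%N => C; apply: maximal_chain_length.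
rewrite interval_in_nested //; have Ac := IA _ Ic; have Ad := IA _ Id.
have cdI x : interval_in le A c d x -> interval_in le A a b x.
  move=> [Ax cx xd]; have [_ ac _] := Ic; have [_ _ db] := Id.
  by split=> //; [apply: (tr a c x)|apply: (tr x d b)].
pose e x := odd (rk x - rk a).
have rankE p : [set x | interval_in le A c d x /\
    exists2 n, has_rank le (interval_in le A a b) x n & p (odd n)] =
    [set x | interval_in le A c d x /\ p (e x)].
  apply/seteqP; split=> x /= [Ix].
    by move=> [n /(has_rankE _ Aa Ab (cdI _ Ix))->].
  move=> ex; split=> //; exists (rk x - rk a)%N => //.
  by apply/has_rankE => //; apply: cdI.
rewrite (rankE id) (rankE negb); apply: signed_count_card.
  exact: intervals_finite.
have := intervals_balanced Ac Ad cd cNd.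
(* Measuring ranks from [a] multiplies the signed count by the sign of [rk a]. *)
rewrite (@signed_count_bij _ _ id (interval_in le A c d) _ _ e (odd (rk a))) => [|//|x].
- by move=> /eqP; rewrite GRing.mulf_eq0 GRing.signr_eq0 => /eqP.
- split=> // x; by exists x.
move=> /cdI[Ax ax _]; rewrite /= /e oddB ?addbK //.
have [->//|/eqP ne] := eqVneq a x; exact/ltnW/rk_lt.
Qed.

End RankedPosets.

(** * Verma's induction from an abstract lifting property *)

Section Lifting.
Import GRing.Theory.
Local Open Scope ring_scope.
Variables (P : choiceType) (le : P -> P -> Prop) (A : set P) (rho : P -> int).
Implicit Types f : P -> P.

(* The lifting property of Bruhat order: f plays the role of multiplication by
   a simple reflection, and f x is a descent of x when le (f x) x. *)
Record lifting f : Prop := Lifting {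
  lift_in : forall x, A x -> A (f x);
  liftK : forall x, A x -> f (f x) = x;
  lift_rank : forall x, A x ->
    (le x (f x) /\ rho (f x) = rho x + 1) \/ (le (f x) x /\ rho x = rho (f x) + 1);
  lift_up : forall x y, A x -> A y -> le (f y) y -> le x y -> le (f x) y;
  lift_down : forall x y, A x -> A y -> le (f x) x -> le (f y) y -> le x y ->
    le (f x) (f y) }.

Hypothesis poA : partial_order_on le A.

Let le_trans x y z : A x -> A y -> A z -> le x y -> le y z -> le x z.
Proof. by case: poA => _ _; apply. Qed.

Lemma lift_min f : lifting f -> forall x y, A x -> A y ->
  le x (f x) -> le (f y) y -> le x y -> le x (f y).
Proof.
move=> lf x y Ax Ay xf fy xy; rewrite -[x in le x _](liftK lf) //.
have Af := lift_in lf Ax.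
by apply: (lift_down lf) => //; [rewrite (liftK lf)|apply: (lift_up lf)].
Qed.

Lemma lift_neq f x : lifting f -> A x -> f x <> x.
Proof. by move=> lf Ax e; have := lift_rank lf Ax; rewrite e; lia. Qed.

Lemma lift_inj f x y : lifting f -> A x -> A y -> f x = f y -> x = y.
Proof. by move=> lf Ax Ay e; rewrite -[x](liftK lf) // e (liftK lf). Qed.

Lemma lift_anti f x : lifting f -> A x -> le x (f x) -> le (f x) x -> False.
Proof.
move=> lf Ax xf fx; apply: (lift_neq lf Ax); case: poA => _ anti _.
by apply: anti => //; apply: (lift_in lf).
Qed.

Lemma odd_rank_lift f x : lifting f -> A x -> odd `|rho (f x)| = ~~ odd `|rho x|.
Proof. by move=> lf Ax; have := lift_rank lf Ax; lia. Qed.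

Hypothesis intervals_finite :
  forall a b, A a -> A b -> finite_set (interval_in le A a b).

(** The bottom [p] is arbitrary because the induction runs over the top only. The second clause will
    make maximal chains meet every rank. *)
Definition lower_balanced q : Prop := forall p, A p -> le p q -> p <> q ->
  signed_count (fun x => odd `|rho x|) (interval_in le A p q) = 0 /\
  (rho q = rho p + 1 \/ exists z, [/\ A z, le p z, le z q, z <> p & z <> q]).

(** [f] preserves such an interval and changes the parity of every rank, so it is a sign-reversing
    involution. *)
Lemma lift_interval_balanced f p q : lifting f -> A p -> A q ->
  le p (f p) -> le (f q) q ->
  signed_count (fun x => odd `|rho x|) (interval_in le A p q) = 0.
Proof.
move=> lf Ap Aq pf fq; apply: (signed_count_involution (f := f)) => x [Ax px xq].
- have Af := lift_in lf Ax; split=> //; last exact: (lift_up lf).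
  case: (lift_rank lf Ax) => -[xf _]; first exact: le_trans px xf.
  exact: lift_min.
- exact: (liftK lf).
- exact: odd_rank_lift.
Qed.

(* When p and q both have the descent f, the intervals [f p, q] and
   [f p, f q] exceed [p, q] and [p, f q] by the same set D. *)
Lemma lower_balanced_lift f q : lifting f -> A q -> le (f q) q ->
  lower_balanced (f q) -> lower_balanced q.
Proof.
move=> lf Aq fq bal p Ap pq pNq; have Afq := lift_in lf Aq.
have Afp := lift_in lf Ap; have rq : rho q = rho (f q) + 1.
  case: (lift_rank lf Aq) => -[] // qf; first by case: (lift_anti lf Aq qf).
case: (lift_rank lf Ap) => -[pf rp].
  split; first exact: (lift_interval_balanced lf).
  have [e|/eqP ne] := eqVneq (f p) q; first by left; rewrite -e.
  right; exists (f p); split=> //; [exact: (lift_up lf)|exact: lift_neq].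
have fpq : le (f p) q by apply: (lift_up lf).
have fpfq : le (f p) (f q) by apply: (lift_down lf).
have fpNfq : f p <> f q by move=> /(lift_inj lf Ap Aq).
have [cnt_fpfq gap] := bal _ Afp fpfq fpNfq.
have fpK : f (f p) = p by apply: (liftK lf).
have le_p x : A x -> le (f p) x -> le (f x) x -> le p x.
  by move=> Ax fpx xf; rewrite -fpK; apply: (lift_up lf).
pose D := [set x | [/\ A x, le (f p) x, le x q & ~ le p x]].
(* If [f] were a descent of an element of [D], lifting would put [p] below it. So [f] raises the
   elements of [D], which therefore stay below [f q]. *)
have asc_D x : A x -> le (f p) x -> ~ le p x -> le x (f x).
  by move=> Ax fpx npx; case: (lift_rank lf Ax) => -[] // /(le_p _ Ax fpx).
have split_q r : A r -> le r q -> (forall x, D x -> le x r) ->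
    signed_count (fun x => odd `|rho x|) (interval_in le A (f p) r) =
    signed_count (fun x => odd `|rho x|) (interval_in le A p r) +
    signed_count (fun x => odd `|rho x|) D.
  move=> Ar rq' Dr; have finD : finite_set D.
    by apply: sub_finite_set (intervals_finite Afp Aq) => x [].
  rewrite -signed_countU //; last by move=> x [[_ px _] [_ _ _ []]].
    congr signed_count; apply/seteqP; split=> [x [Ax fpx xr]|x [[Ax px xr]|Dx]].
    - have [px|npx] := pselect (le p x); [by left|right; split=> //].
      exact: le_trans xr rq'.
    - by split=> //; apply: le_trans px.
    - by case: (Dx) => Ax fpx _ _; split=> //; apply: Dr.
  exact: intervals_finite.
have Dq x : D x -> le x q by case.
have Dfq x : D x -> le x (f q).
  by move=> [Ax fpx xq npx]; apply: (lift_min lf) => //; apply: asc_D.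
have poR : le q q by case: poA => rf _ _; apply: rf.
have cnt_fpq : signed_count (fun x => odd `|rho x|) (interval_in le A (f p) q) = 0.
  by apply: (lift_interval_balanced lf) => //; rewrite fpK.
have pNfq : p <> f q.
  move=> e; apply: (lift_anti lf Afq); first by rewrite (liftK lf).
  by rewrite -e.
split.
  have cnt_pfq : signed_count (fun x => odd `|rho x|) (interval_in le A p (f q)) = 0.
    have [pfq|npfq] := pselect (le p (f q)); first by have [] := bal _ Ap pfq pNfq.
    rewrite (_ : interval_in _ _ _ _ = set0) ?signed_count0 //.
    apply/seteqP; split=> // x [Ax px xfq]; apply: npfq; exact: le_trans xfq.
  have := split_q _ Aq poR Dq; have := split_q _ Afq fq Dfq.
  by rewrite cnt_pfq cnt_fpq cnt_fpfq !add0r => <-; rewrite addr0.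
(* If [p] is below [f q], then [f q] refines the pair. Otherwise an element [z] between [f p] and
   [f q] cannot have the descent [f], as that would give [p] below [z]; hence [f z] lies between [p]
   and [q]. *)
have [pfq|npfq] := pselect (le p (f q)).
  by right; exists (f q); split=> //; [move/esym|apply: lift_neq].
case: gap => [e|[z [Az fpz zfq zNfp zNfq]]]; first by left; rewrite rq e -rp.
have Afz := lift_in lf Az; right; exists (f z).
have zq : le z q by apply: le_trans zfq fq.
case: (lift_rank lf Az) => -[zf _]; last first.
  by case: npfq; apply: le_trans (le_p _ Az fpz zf) zfq.
split=> //.
- apply: le_p => //; last by rewrite (liftK lf).
  exact: le_trans fpz zf.
- exact: (lift_up lf).
- by move=> e; apply: zNfp; rewrite -e (liftK lf).
- by move=> e; apply: zNfq; rewrite -e (liftK lf).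
Qed.

(* The elements of the two lower sets that f, respectively g, does not pair off
   inside Q correspond to each other under g \o f. *)
Lemma lower_count_lift f g (Q : set P) q : lifting f -> lifting g ->
  (forall x, A x -> f (g x) = g (f x)) -> Q `<=` A ->
  (forall x y, Q x -> A y -> le x y -> Q y) ->
  (forall x, A x -> ~ Q x -> Q (f x) <-> Q (g x)) ->
  (forall y, A y -> finite_set [set x | Q x /\ le x y]) ->
  Q q -> le (f q) q ->
  exists q', [/\ Q q', q' = f q \/ q' = g (f q) &
    signed_count (fun x => odd `|rho x|) [set x | Q x /\ le x q] =
    signed_count (fun x => odd `|rho x|) [set x | Q x /\ le x q']].
Proof.
move=> lf lg fgC QA Qup Qfg finQ Qq fq; have Aq := QA _ Qq.
have Afq := lift_in lf Aq; have Agfq := lift_in lg Afq.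
(* [h] cancels in pairs the elements that it keeps inside [Q]. *)
have unpaired h y : lifting h -> A y -> le (h y) y ->
    signed_count (fun x => odd `|rho x|) [set x | Q x /\ le x y] =
    signed_count (fun x => odd `|rho x|) [set x | [/\ Q x, le x y & ~ Q (h x)]].
  move=> lh Ay hy; pose S := [set x | [/\ Q x, le x y & Q (h x)]].
  have -> : [set x | Q x /\ le x y] =
      S `|` [set x | [/\ Q x, le x y & ~ Q (h x)]].
    apply/seteqP; split=> [x /= [Qx xy]|x /= [[]|[]] //].
    by have [Qhx|nQ] := pselect (Q (h x)); [left|right].
  rewrite signed_countU; [|by apply: sub_finite_set (finQ y Ay) => x []..|].
    rewrite (signed_count_involution (f := h)) ?add0r //.
    - move=> x [Qx xy Qhx]; split=> //; last by rewrite (liftK lh) //; apply: QA.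
      by apply: (lift_up lh) => //; apply: QA.
    - by move=> x [Qx _ _]; apply: (liftK lh); apply: QA.
    - by move=> x [Qx _ _]; apply: odd_rank_lift lh _; apply: QA.
  by move=> x [[_ _ Qx] [_ _ []]].
(* [q'] is the upper one of [f q] and [g (f q)], so that it has the descent [g]. *)
have [q' [Aq' e gq' fqq' lower_g]] : exists q',
    [/\ A q', q' = f q \/ q' = g (f q),
    le (g q') q', le (f q) q' &
    forall x, A x -> le x q' -> le (g x) x -> le (g x) (f q)].
  case: (lift_rank lg Afq) => -[gfq _]; [exists (g (f q))|exists (f q)].
    split=> //; [by right|by rewrite (liftK lg)|].
    move=> x Ax xq' gx; rewrite -(liftK lg Afq).
    by apply: (lift_down lg) => //; rewrite (liftK lg).
  have rfq : le (f q) (f q) by case: poA => rf _ _; apply: rf.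
  split=> //; first by left.
  by move=> x Ax xq' gx; apply: le_trans gx xq' => //; apply: (lift_in lg).
have Qq' : Q q'.
  have [Qfq|nQfq] := pselect (Q (f q)); first exact: Qup fqq'.
  have Qgfq : Q (g (f q)) by apply/Qfg => //; rewrite (liftK lf).
  by case: e => [e|->//]; rewrite e in gq' *; apply: Qup gq'.
exists q'; split=> //; rewrite (unpaired f) // (unpaired g q') //.
(* [g \o f] changes parity twice, hence the sign [false]. Its images lie in [Q] by the hypothesis on
   elements outside [Q], applied to [f p], and to [g p'] for the inverse. *)
rewrite [RHS](@signed_count_bij _ _ (g \o f)
  [set x | [/\ Q x, le x q & ~ Q (f x)]] _ _ (fun x => odd `|rho x|) false) ?mul1r //.
  split=> [p [Qp pq nQfp]|x y /set_mem[Qx _ _] /set_mem[Qy _ _] /= exy|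
    p' [Qp' pq' nQgp']].
  - have Ap := QA _ Qp; have Afp := lift_in lf Ap.
    have Qgfp : Q (g (f p)) by apply/Qfg => //; rewrite (liftK lf).
    split=> //=; last by rewrite (liftK lg).
    apply: (lift_up lg) => //; apply: le_trans fqq' => //.
    apply: (lift_down lf) => //; case: (lift_rank lf Ap) => -[] // pf _.
    by case: nQfp; apply: Qup pf.
  - have [Ax Ay] := (QA _ Qx, QA _ Qy).
    by apply: (lift_inj lf) => //; apply: (lift_inj lg) => //; apply: (lift_in lf).
  - have Ap' := QA _ Qp'; have Agp' := lift_in lg Ap'.
    exists (f (g p')); last by rewrite /= (liftK lf) // (liftK lg).
    have Qfgp' : Q (f (g p')) by apply/Qfg => //; rewrite (liftK lg).
    split=> //; last by rewrite (liftK lf).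
    apply: (lift_up lf) => //; apply: le_trans fq => //; apply: lower_g => //.
    case: (lift_rank lg Ap') => -[] // p'g _.
    by case: nQgp'; apply: Qup p'g.
move=> p [Qp _ _]; have Ap := QA _ Qp; have Afp := lift_in lf Ap.
by rewrite /= !odd_rank_lift // negbK addbF.
Qed.

End Lifting.

(** * The order on cosets of the diagonal of W_J *)

Section CosetPairs.
Local Open Scope group_scope.
Variables (I : Type) (W : groupType) (s : I -> W) (J : set I).
Hypothesis cox : coxeter_system s.
Implicit Types (u v w x y t r a b : W) (p q : W * W).

Local Notation len := (cox_length s).
Local Notation "x <=B y" := (bruhat s x y) (at level 70, no associativity).

(** By the cocycle identity [a * s j * a^-1] is not an inversion of [a * v], since it is none of [a]
    and [s j] is none of [v]. *)
Lemma len_mul_between a v j : len a < len (a * s j) -> len v < len (s j * v) ->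
  len (a * v) < len (a * s j * v).
Proof.
move=> aj jv; have rR := reflectionVJ a (reflection_simple s j).
have := inversionM cox a v rR.
have := neq_len_reflection cox (a * v) rR.
have -> : (a * s j * a^-1) ^ a = s j by rewrite conjgE mulgVK mulKg.
have e x : a * s j * a^-1 * (a * x) = a * s j * x by rewrite !mulgA mulgVK.
rewrite e mulgVK (ltnNge (len (a * s j))) (ltnW aj).
by rewrite (ltnNge (len (s j * v))) (ltnW jv) /=; case: ltngtP.
Qed.

(* The triple (x, u, w) is encoded by the pair (x u^-1, w); these pairs
   represent the diagonal W_J-cosets in W x W. *)
Definition coset_pair : set (W * W) := [set p | min_rep s J p.2].

Definition pair_le p q : Prop := exists2 v, parabolic s J v &
  q.1 <=B p.1 * v /\ p.2 * v <=B q.2.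

Definition pair_rank p : int := ((len p.2)%:Z - (len p.1)%:Z)%R.

Definition mul_fst i p := (s i * p.1, p.2).

(** If [s i * w] is not minimal, then [s i * w = w * s j] with [s j = w^-1 * s i * w], and the
    diagonal coset of [(a, w * s j)] is represented by [(a * s j, w)]. *)
Definition mul_snd i p :=
  if `[< min_rep s J (s i * p.2) >] then (p.1, s i * p.2)
  else (p.1 * (p.2^-1 * s i * p.2), p.2).

(** [l(a') <= l(a) + l(v)] and [l(w) + l(v) <= l(w')]. Equal ranks make both tight, and then [v = 1]
    because [w] and [w * v] are both minimal. *)
Lemma pair_le_rank p q : coset_pair p -> pair_le p q ->
  (pair_rank p <= pair_rank q)%R /\
  (pair_rank p = pair_rank q -> coset_pair q -> p = q).
Proof.
case: p q => a w [a' w'] mw [v Jv /= [le1 le2]].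
have := min_rep_len cox mw Jv; have := cox_lengthM cox a v.
have := bruhat_len le1; have := bruhat_len le2.
rewrite /pair_rank /= => l1 l2 l3 l4; split; first lia.
move=> e mw'; have e1 := bruhat_len_eq le1; have e2 := bruhat_len_eq le2.
have ew : w * v = w' by apply: e2; lia.
have v1 := min_rep_inj cox mw mw' Jv ew.
by rewrite -ew e1 v1 ?mulg1 //; lia.
Qed.

Lemma pair_le_trans p q p' : coset_pair p -> coset_pair q ->
  pair_le p q -> pair_le q p' -> pair_le p p'.
Proof.
case: p q p' => a w [a' w'] [a'' w''] _ mw' [v Jv /= [le1 le2]].
move=> [v' Jv' /= [le1' le2']].
(* Multiply [a'] and [w'] along a reduced word of [v']; [V] gains the letter [s j] only when [s j]
   lengthens both [a' * u] and [a * V]. *)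
suff [V JV [leV1 leV2]] : pair_le (a, w) (a' * v', w' * v').
  exists V => //; split; first exact: bruhat_trans le1' leV1.
  exact: bruhat_trans leV2 le2'.
move: v' Jv' {le1' le2'}; apply: (parabolic_ind cox) => [|u j Ju Jj e [V JV /= [IH1 IH2]]].
  by exists v => //=; rewrite !mulg1.
have lt : len (w' * u) < len (w' * u * s j).
  rewrite -mulgA !(min_rep_len cox mw') ?e ?ltn_add2l //.
  by apply: parabolicM => //; apply: parabolic_simple.
have Jj' : parabolic s J (s j) by apply: parabolic_simple.
have JVj : parabolic s J (V * s j) by apply: parabolicM.
have up : w' * u <=B w' * u * s j by apply: bruhat_simpleR.
rewrite /pair_le /= !mulgA.
have keep : a' * u * s j <=B a * V -> pair_le (a, w) (a' * u * s j, w' * u * s j).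
  by move=> H; exists V => //; split=> //; apply: bruhat_trans IH2 up.
have [e1|e1] := len_simpleR cox (a' * u) j; last first.
  apply: keep; apply: bruhat_trans IH1; apply: bruhat_simpleR_dec => //.
  by rewrite [X in _ < X]e1.
have [e2|e2] := len_simpleR cox (a * V) j; last first.
  by apply: keep; apply: bruhat_liftR => //; rewrite [X in _ < X]e2.
exists (V * s j) => //; rewrite !mulgA; split; apply: bruhat_liftR_up => //.
by rewrite e2.
Qed.

Lemma pair_le_po : partial_order_on pair_le coset_pair.
Proof.
split=> [p _|p q Ap Aq pq qp|p q p' Ap Aq _].
- exists 1; first exact: (parabolic1 cox).
  by rewrite !mulg1; split; apply: bruhat_refl.
- have [le1 eq1] := pair_le_rank Ap pq; have [le2 _] := pair_le_rank Aq qp.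
  by apply: eq1 => //; apply: Order.POrderTheory.le_anti; rewrite le1 le2.
- exact: pair_le_trans.
Qed.

(** * Lifting property of left multiplication in either factor *)

Lemma pair_le1 p q : q.1 <=B p.1 -> p.2 <=B q.2 -> pair_le p q.
Proof. by exists 1; rewrite ?mulg1; first exact: (parabolic1 cox). Qed.

(** The first coordinate enters the order reversed, so a descent of the pair is an ascent in [W]. *)
Lemma mul_fst_descent i q : coset_pair q -> pair_le (mul_fst i q) q ->
  len q.1 < len (s i * q.1).
Proof.
move=> Aq /pair_le_rank[]; rewrite /pair_rank /= => // + _.
by case: (len_simpleL cox i q.1) => ->; lia.
Qed.

Lemma mul_fst_lifting i : lifting pair_le coset_pair pair_rank (mul_fst i).
Proof.
split=> [//|[a w] _|[a w] mw|[a w] [a' w'] mw mw' d|[a w] [a' w'] mw mw' d d'].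
- by rewrite /mul_fst /= simple_mulK.
- rewrite /pair_rank /=; case: (len_simpleL cox i a) => e; [right|left].
    split; last lia; apply: pair_le1; last exact: bruhat_refl.
    by apply: bruhat_simpleL; rewrite // e.
  split; last lia; apply: pair_le1; last exact: bruhat_refl.
  by apply: bruhat_simpleL_dec; rewrite // [X in _ < X]e.
- have /= lt := mul_fst_descent mw' d; move=> [v Jv /= [le1 le2]].
  exists v => //=; split => //; rewrite -mulgA.
  case: (len_simpleL cox i (a * v)) => e.
    by apply: bruhat_trans le1 _; apply: bruhat_simpleL; rewrite // e.
  by apply: bruhat_liftL_min; rewrite // [X in _ < X]e.
- have /= lt' := mul_fst_descent mw' d'; have /= lt := mul_fst_descent mw d.
  move=> [v Jv /= [le1 le2]]; case: (len_simpleL cox i (a * v)) => e.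
    exists v => //=; split => //; rewrite -mulgA.
    by apply: bruhat_liftL_up; rewrite // e.
  (* Here [s i] shortens [a * v] but not [a], so exchange deletes a letter of [v]: [s i ^ a * v] is
     shorter, stays in [W_J], and satisfies [a * (s i ^ a * v) = s i * (a * v)]. *)
  have rr := reflectionJ a (reflection_simple s i).
  have := inversionM cox a v (reflection_simple s i).
  rewrite [len (a * v)]e ltnSn ltnNge (ltnW lt) /= => /esym ltv.
  have [_ rv_word] := deletion cox rr (parabolic_word cox Jv) ltv.
  have Jrv : parabolic s J (s i ^ a * v).
    by apply/(parabolicP cox); exists (len v).-1.
  exists (s i ^ a * v) => //=.
  have eav : a * (s i ^ a * v) = s i * (a * v) by rewrite mulgA -conjgC mulgA.
  rewrite -mulgA eav simple_mulK //; split.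
    by apply: bruhat_liftL; rewrite // [X in _ < X]e.
  apply: bruhat_trans le2.
  have rw := reflectionVJ w rr.
  have e' : w * s i ^ a * w^-1 * (w * (s i ^ a * v)) = w * v.
    by rewrite mulgA mulgVK -mulgA (reflectionK cox _ rr).
  rewrite -e'; apply: bruhat_step => //.
  by rewrite e' !(min_rep_len cox mw) // ltn_add2l.
Qed.

Lemma bruhat_mul_between a v j : len a < len (a * s j) -> len v < len (s j * v) ->
  a * v <=B a * s j * v.
Proof.
move=> aj jv; have := len_mul_between aj jv.
have -> : a * s j * v = a * s j * a^-1 * (a * v) by rewrite !mulgA mulgVK.
by move=> lt; apply: bruhat_step => //; apply/reflectionVJ/reflection_simple.
Qed.

Lemma mul_sndP i a w : min_rep s J w ->
  (min_rep s J (s i * w) /\ mul_snd i (a, w) = (a, s i * w)) \/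
  (exists j, [/\ J j, s i * w = w * s j, len w < len (w * s j)
    & mul_snd i (a, w) = (a * s j, w)]).
Proof.
move=> mw; rewrite /mul_snd /=; case: asboolP => [|nm]; [by left|right].
case: (min_rep_mulL cox i mw) => // -[j Jj e]; exists j; split=> //.
  exact: (min_rep_simple_lt cox mw).
by rewrite -mulgA e mulKg.
Qed.

(** Absorbing [s j] into [v] makes both branches of [mul_snd] give the condition for the
    unnormalised pair [(p.1, s i * p.2)]. *)
Lemma pair_le_mul_snd i p q : coset_pair p ->
  pair_le (mul_snd i p) q <->
  exists2 v, parabolic s J v & q.1 <=B p.1 * v /\ s i * p.2 * v <=B q.2.
Proof.
case: p => a w mw; have [[_ ->]//|[j [Jj e _ ->]]] := mul_sndP i a mw.
have Jsj := parabolic_simple cox Jj; split=> /= -[v Jv [le1 le2]];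
  exists (s j * v); rewrite ?mulgA ?mul_simpleK //; try exact: parabolicM.
  by rewrite e mul_simpleK.
by rewrite -e.
Qed.

Lemma mul_snd_descent i q : coset_pair q -> pair_le (mul_snd i q) q ->
  (min_rep s J (s i * q.2) /\ len (s i * q.2) < len q.2 /\
   mul_snd i q = (q.1, s i * q.2)) \/
  (exists j, [/\ J j, s i * q.2 = q.2 * s j, len q.2 < len (q.2 * s j),
    len q.1 < len (q.1 * s j) & mul_snd i q = (q.1 * s j, q.2)]).
Proof.
case: q => a w mw d; have [[m e]|[j [Jj e lt es]]] := mul_sndP i a mw; [left|right].
  move: d; rewrite e => /pair_le_rank[] // + _; rewrite /pair_rank /=.
  by case: (len_simpleL cox i w) => el; split=> //; split=> //; lia.
exists j; split=> //=; move: d; rewrite es => /pair_le_rank[] // + _.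
by rewrite /pair_rank /=; case: (len_simpleR cox a j) => el; lia.
Qed.

(** If [s i] shortens [w * x], take [v = x]. Otherwise additivity of lengths prevents [s i] from
    shortening [w], so [s i * w = w * s j], and [v = s j * x] makes [s i * w * v] equal to
    [w * x]. *)
Lemma mul_snd_descent_lift i a w x y : min_rep s J w ->
  pair_le (mul_snd i (a, w)) (a, w) -> parabolic s J x ->
  len (s i * y) < len y -> w * x <=B y ->
  exists2 v, parabolic s J v & a * x <=B a * v /\ s i * w * v <=B s i * y.
Proof.
move=> mw d Jx ly wxy.
have [lt|ge] := ltnP (len (s i * (w * x))) (len (w * x)).
  exists x => //; split; first exact: bruhat_refl.
  by rewrite -mulgA; apply: bruhat_lift2L.
have lt : len (w * x) < len (s i * (w * x)).
  by case: (len_simpleL cox i (w * x)) ge => -> //; rewrite ltnn.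
case: (@mul_snd_descent i (a, w) mw d) => /= [[m [l _]]|[j [Jj e _ la _]]].
  by move: lt; rewrite mulgA (min_rep_len cox m) // (min_rep_len cox mw) //; lia.
have Jsj := parabolic_simple cox Jj; have Jjx : parabolic s J (s j * x).
  exact: parabolicM.
have lx : len x < len (s j * x).
  by move: lt; rewrite mulgA e -mulgA !(min_rep_len cox mw) // ltn_add2l.
exists (s j * x) => //; split; first by rewrite mulgA; apply: bruhat_mul_between.
rewrite e -!mulgA simple_mulK //; exact: bruhat_liftL_min.
Qed.

Lemma mul_snd_lifting i : lifting pair_le coset_pair pair_rank (mul_snd i).
Proof.
have snd_in p : coset_pair p -> coset_pair (mul_snd i p).
  by case: p => a w mw; case: (mul_sndP i a mw) => [[m ->]|[j [_ _ _ ->]]].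
split=> // [[a w] mw|[a w] mw|[a w] [a' w'] mw mw' d|[a w] [a' w'] mw mw' d d'].
- have [[m ->]|[j [Jj e _ ->]]] := mul_sndP i a mw.
    have [[_ ->]|[j [Jj e _ _]]] := mul_sndP i a m; first by rewrite simple_mulK.
    have := min_rep_simple_lt cox m Jj; have := min_rep_simple_lt cox mw Jj.
    have -> : w * s j = s i * w.
      by rewrite -[w in LHS](simple_mulK cox i) e mul_simpleK.
    by rewrite -e simple_mulK // => /= l1 l2; exfalso; lia.
  have [[m _]|[k [Jk ek _ ->]]] := mul_sndP i (a * s j) mw; last first.
    by move: ek; rewrite e => /mulgI <-; rewrite mul_simpleK.
  have := min_rep_simple_lt cox m Jj; have := min_rep_simple_lt cox mw Jj.
  by rewrite e mul_simpleK // => /= l1 l2; exfalso; lia.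
- have [[m ->]|[j [Jj e _ ->]]] := mul_sndP i a mw; rewrite /pair_rank /=.
    case: (len_simpleL cox i w) => el; [left|right]; split; try lia;
      apply: pair_le1; try exact: bruhat_refl.
      by apply: bruhat_simpleL; rewrite el.
    by apply: bruhat_simpleL_dec; rewrite // [X in _ < X]el.
  case: (len_simpleR cox a j) => el; [right|left]; split; try lia;
    apply: pair_le1; try exact: bruhat_refl.
    by apply: bruhat_simpleR; rewrite // el.
  by apply: bruhat_simpleR_dec; rewrite // [X in _ < X]el.
- move=> [v Jv /= [le1 le2]]; apply/pair_le_mul_snd => //=; rewrite /=.
  case: (@mul_snd_descent i (a', w') mw' d) => /= [[_ [l _]]|[j [Jj e lw la _]]].
    by exists v => //; split=> //; rewrite -mulgA; apply: bruhat_liftL.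
  have Jsj := parabolic_simple cox Jj.
  have [lt|ge] := ltnP (len (s i * (w * v))) (len (w * v)).
    exists v => //; split=> //; rewrite -mulgA; apply: bruhat_trans le2.
    exact: bruhat_simpleL_dec.
  (* To remove [s j] from the bound, keep [v] if [s j] lengthens [s i * w * v] on the right, and
     take [v * s j] if it shortens it. *)
  have le3 : s i * w * v <=B w' * s j.
    by rewrite -e -mulgA; apply: bruhat_liftL_up; rewrite // e.
  have lw' : len (w' * s j * s j) < len (w' * s j) by rewrite mul_simpleK.
  case: (len_simpleR cox (s i * w * v) j) => el.
    exists v => //; split => //.
    by rewrite -[w'](mul_simpleK cox j); apply: bruhat_liftR_min; rewrite // el.
  exists (v * s j); rewrite ?mulgA; first exact: parabolicM.
  split; last first.
    rewrite -[w'](mul_simpleK cox j).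
    by apply: bruhat_lift2R; rewrite // [X in _ < X]el.
  case: (len_simpleR cox (a * v) j) => ea.
    by apply: bruhat_trans le1 _; apply: bruhat_simpleR; rewrite // ea.
  by apply: bruhat_liftR_min; rewrite // [X in _ < X]ea.
- move=> [v Jv /= [le1 le2]]; apply/pair_le_mul_snd => //=.
  case: (@mul_snd_descent i (a', w') mw' d') => /= [[_ [l ->]]|[j [Jj e lw la ->]]] /=.
    have [v' Jv' [le3 le4]] := mul_snd_descent_lift mw d Jv l le2.
    by exists v' => //; split=> //; apply: bruhat_trans le1 le3.
  have Jsj := parabolic_simple cox Jj.
  have ly : len (s i * (w' * s j)) < len (w' * s j).
    by rewrite -e simple_mulK // e.
  have sy : s i * (w' * s j) = w' by rewrite -e simple_mulK.
  (* [w' * s j] has the descent [s i] and is sent to [w'], so [mul_snd_descent_lift] applies to any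
     such [x]: take [v * s j] or [v], according to whether [s j] lengthens [a * v]. *)
  suff [x [Jx le3 le4]] : exists x, [/\ parabolic s J x, a' * s j <=B a * x
      & w * x <=B w' * s j].
    have [v' Jv' [le5 le6]] := mul_snd_descent_lift mw d Jx ly le4.
    by exists v' => //; rewrite sy in le6; split=> //; apply: bruhat_trans le3 le5.
  case: (len_simpleR cox (a * v) j) => ea.
    exists (v * s j); rewrite !mulgA; split; first exact: parabolicM.
      by apply: bruhat_liftR_up; rewrite // ea.
    exact: bruhat_liftR_up.
  exists v; split=> //; first by apply: bruhat_liftR; rewrite // [X in _ < X]ea.
  by apply: bruhat_trans le2 _; apply: bruhat_simpleR.
Qed.

(** * Balanced intervals in [W] and among pairs *)

Lemma bruhat_po : partial_order_on (bruhat s) [set: W].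
Proof.
split=> [x _|x y _ _|x y z _ _ _]; [exact: bruhat_refl|exact: bruhat_anti|].
exact: bruhat_trans.
Qed.

Lemma bruhat_lifting i :
  lifting (bruhat s) [set: W] (fun x => (len x)%:Z%R) (fun x => s i * x).
Proof.
have desc y : s i * y <=B y -> len (s i * y) < len y.
  by move=> /bruhat_len; case: (len_simpleL cox i y) => ->; lia.
split=> // [x _|x _|x y _ _ /desc|x y _ _ /desc lx /desc ly].
- exact: simple_mulK.
- case: (len_simpleL cox i x) => e; [left|right]; (split; last lia).
    by apply: bruhat_simpleL; rewrite // e.
  by apply: bruhat_simpleL_dec; rewrite // [X in _ < X]e.
- exact: bruhat_liftL.
- exact: bruhat_lift2L.
Qed.

Lemma descentL_exists w : w <> 1 -> exists i, len (s i * w) < len w.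
Proof.
move=> w1; have [+ _] := cox_lengthP cox w^-1; rewrite cox_lengthV //.
case/word_in_inv => [[e _]|[n [v [i [e wv vn _]]]]].
  by case: w1; apply: (cox_length0 cox).
exists i; rewrite -[w]invgK wv (mulVsimple cox) simple_mulK // -(mulVsimple cox).
by rewrite !cox_lengthV // -wv cox_lengthV // e ltnS; apply: cox_length_le vn.
Qed.

Lemma bruhat_interval_finite a b : finite_set (interval_in (bruhat s) [set: W] a b).
Proof. by apply: sub_finite_set (bruhat_finite cox b) => x []. Qed.

(** Verma's induction in [W] itself, needed for the pairs below a pair with second coordinate 1. *)
Lemma bruhat_balanced y :
  lower_balanced (bruhat s) [set: W] (fun x => (len x)%:Z%R) y.
Proof.
have [n] := ubnP (len y); elim: n => // n IH in y * => le_n.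
have [e|/eqP y1] := eqVneq y 1.
  move=> p _ py pNy; case: pNy; apply: bruhat_len_eq py _.
  by rewrite e cox_length1.
have [i lt] := descentL_exists y1.
apply: (lower_balanced_lift bruhat_po _ (bruhat_lifting i)) => //.
- by move=> a b _ _; apply: bruhat_interval_finite.
- exact: bruhat_simpleL_dec.
- by apply: IH; apply: leq_trans lt le_n.
Qed.

Hypothesis finJ : finite_set (parabolic s J).

(** First coordinates lie below [p.1 * v] for one of finitely many [v]; second coordinates lie below
    [q.2] by minimality. *)
Lemma pair_interval_finite p q : coset_pair p -> coset_pair q ->
  finite_set (interval_in pair_le coset_pair p q).
Proof.
move=> mp mq; apply: (@sub_finite_set _ _
  ((\bigcup_(v in parabolic s J) [set c | c <=B p.1 * v]) `*` [set d | d <=B q.2])).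
  move=> [c d] [/= md [v Jv /= [le1 le2]] [v' Jv' /= [le3 le4]]]; split=> /=.
    by exists v.
  exact: bruhat_trans (bruhat_min_le cox md Jv') le4.
apply: finite_setX; last exact: bruhat_finite.
by apply: bigcup_finite => // v _; apply: bruhat_finite.
Qed.

Lemma coset_pair_balanced q : coset_pair q ->
  lower_balanced pair_le coset_pair pair_rank q.
Proof.
have [n] := ubnP (len q.2); elim: n => // n IH in q * => le_n mq.
have [q1|/eqP q1] := eqVneq q.2 1; last first.
  have [i lt] := descentL_exists q1; have lq := mul_snd_lifting i.
  have e : mul_snd i q = (q.1, s i * q.2).
    by rewrite /mul_snd asboolT //; apply: min_rep_descent.
  apply: (lower_balanced_lift pair_le_po _ lq) => //; rewrite ?e.
  - exact: pair_interval_finite.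
  - by apply: pair_le1; [apply: bruhat_refl|apply: bruhat_simpleL_dec].
  - by apply: IH; [apply: leq_trans lt le_n|apply: min_rep_descent].
case: q q1 mq {le_n IH} => a' w' /= -> m1 [a w] mw.
have below c d : coset_pair (c, d) -> pair_le (c, d) (a', 1) -> d = 1 /\ a' <=B c.
  move=> md [v Jv /= [le1 le2]].
  have dv : d * v = 1 by apply: bruhat_len_eq le2 _; rewrite cox_length1.
  have v1 := min_rep_inj cox md m1 Jv dv.
  by rewrite v1 !mulg1 in dv le1.
move=> /[dup] pq /(below _ _ mw)[ew a'a] pNq; rewrite {w}ew in mw pq pNq *.
(* The order is reversed on first coordinates, so [a'] is the bottom and [a] the top. *)
have [|||cnt gap] := bruhat_balanced (p := a') (y := a) => //.
  by move=> e; apply: pNq; rewrite e.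
split.
  rewrite (@signed_count_bij _ _ (fun c => (c, 1)) (interval_in (bruhat s) setT a' a)
    _ _ (fun x => odd `|(len x)%:Z%R|) false) ?cnt ?mulr0 //.
    split=> [c [_ a'c ca]|c d _ _ [] //|
      [c d] [md pc /[dup] cq /(below _ _ md)[ed a'c]]].
    - by split=> //; apply: pair_le1 => //; apply: bruhat_refl.
    - exists c; last by rewrite ed.
      rewrite /= ed in md pc; split=> //; case: pc => v Jv /= [le1 le2].
      suff v1 : v = 1 by rewrite v1 mulg1 in le1.
      apply: (min_rep_inj cox m1 m1 Jv); apply: bruhat_len_eq le2 _.
      by rewrite cox_length1.
  by move=> c _; rewrite /pair_rank /= cox_length1 //; lia.
case: gap => [e|[c [_ a'c ca cNa' cNa]]]; [left|right].
  by rewrite /pair_rank /=; lia.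
exists (c, 1); split=> //; try by apply: pair_le1 => //; apply: bruhat_refl.
- by move=> [].
- by move=> [].
Qed.

(* The pairs coming from triples (x, u, w) with x <= w u. *)
Definition bounded_pair : set (W * W) := [set p | min_rep s J p.2 /\ p.1 <=B p.2].

(** * The up-closed set of bounded pairs *)

Lemma bounded_pair_up p q :
  bounded_pair p -> coset_pair q -> pair_le p q -> bounded_pair q.
Proof.
move=> [mp pp] mq [v Jv [le1 le2]]; split=> //; apply: bruhat_trans le1 _.
exact: bruhat_trans (bruhat_parabolic_mono cox mp Jv pp) le2.
Qed.

Lemma mul_snd_fst i p : mul_snd i (mul_fst i p) = mul_fst i (mul_snd i p).
Proof. by rewrite /mul_snd /mul_fst /=; case: asboolP => //= _; rewrite -(mulgA (s i)). Qed.

(** Everything reduces to [a <=B s i * w] and [s i * a <=B w], equivalent when [a <=B w] fails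
    because either then forces [s i] to lengthen [w]. When [s i * w = w * s j], lifting by [s j] on
    the right brings [a * s j <=B w] to this form. *)
Lemma bounded_pair_mul i p : coset_pair p -> ~ bounded_pair p ->
  bounded_pair (mul_snd i p) <-> bounded_pair (mul_fst i p).
Proof.
case: p => a w mw nb; have naw : ~ a <=B w by move=> aw; apply: nb.
have asc : ~ (s i * a <=B w) \/ len w < len (s i * w).
  have [lt|ge] := ltnP (len w) (len (s i * w)); [by right|left].
  move=> saw; apply: naw; rewrite -[a](simple_mulK cox i).
  apply: bruhat_liftL => //.
  by case: (len_simpleL cox i w) ge => -> //; rewrite ltnn.
have from_sw : a <=B s i * w -> s i * a <=B w.
  move=> asw; have [lt|ge] := ltnP (len w) (len (s i * w)); last first.
    by case: naw; apply: bruhat_trans asw _; apply: bruhat_simpleL_dec => //;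
      case: (len_simpleL cox i w) ge => ->; rewrite ?ltnn.
  rewrite -[w](simple_mulK cox i); have lt' : len (s i * (s i * w)) < len (s i * w).
    by rewrite simple_mulK.
  case: (len_simpleL cox i a) => e; last first.
    by apply: bruhat_lift2L; rewrite // [X in _ < X]e.
  case: naw; rewrite -[w](simple_mulK cox i).
  by apply: bruhat_liftL_min; rewrite // e.
have to_sw : s i * a <=B w -> a <=B s i * w.
  move=> saw; case: asc => // lt; rewrite -[a](simple_mulK cox i).
  exact: bruhat_liftL_up.
have [[m ->]|[j [Jj e lt ->]]] := mul_sndP i a mw.
  by split=> -[/= _ H]; split=> //=; [apply: from_sw|apply: to_sw].
split=> -[/= _ H]; split=> //=.
  apply: from_sw; rewrite e -[a](mul_simpleK cox j).
  exact: bruhat_liftR_up.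
move: H => /to_sw; rewrite e => awj.
have ltj : len (w * s j * s j) < len (w * s j) by rewrite mul_simpleK.
rewrite -[w](mul_simpleK cox j).
case: (len_simpleR cox a j) => ea; last first.
  by apply: bruhat_lift2R; rewrite // [X in _ < X]ea.
case: naw; rewrite -[w](mul_simpleK cox j).
by apply: bruhat_liftR_min; rewrite // ea.
Qed.

Lemma bounded_pair_lower_finite q : finite_set [set p | bounded_pair p /\ pair_le p q].
Proof.
apply: (@sub_finite_set _ _ ([set c | c <=B q.2] `*` [set d | d <=B q.2])).
  move=> [c d] /= [[/= md cd] [v Jv /= [_ le]]].
  have dq := bruhat_trans (bruhat_min_le cox md Jv) le.
  by split=> //=; apply: bruhat_trans cd dq.
by apply: finite_setX; apply: bruhat_finite.
Qed.

Lemma bounded_pair_lower_count q : bounded_pair q ->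
  signed_count (fun p => odd `|pair_rank p|)
    [set p | bounded_pair p /\ pair_le p q] = 1%R.
Proof.
have [n] := ubnP (len q.2); elim: n => // n IH in q * => le_n Qq.
have [q1|/eqP q1] := eqVneq q.2 1.
  case: q q1 Qq {le_n} => a w /= -> [/= m1 a1].
  rewrite (_ : [set p | _] = [set (1, 1)]).
    by rewrite signed_count1 /pair_rank /= GRing.subrr.
  have below c : c <=B 1 -> c = 1.
    by move=> le; apply: bruhat_len_eq le _; rewrite cox_length1.
  rewrite {a a1}(below _ a1); apply/seteqP; split=> [[c d]|p ->] /=.
    move=> [[/= md cd] [v Jv /= [_ le]]].
    have d1 : d = 1.
      by apply: below; apply: bruhat_trans (bruhat_min_le cox md Jv) le.
    by rewrite d1 in cd *; rewrite (below _ cd).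
  by split; [split=> //=; apply: bruhat_refl|apply: pair_le1; apply: bruhat_refl].
have [i lt] := descentL_exists q1; have mq := Qq.1.
have e : mul_snd i q = (q.1, s i * q.2).
  by rewrite /mul_snd asboolT //; apply: min_rep_descent.
have [] := lower_count_lift pair_le_po (q := q) (Q := bounded_pair)
  (mul_snd_lifting i) (mul_fst_lifting i) => //.
- by move=> x _; apply: mul_snd_fst.
- by move=> x [].
- exact: bounded_pair_up.
- exact: bounded_pair_mul.
- by move=> y _; apply: bounded_pair_lower_finite.
- by rewrite e; apply: pair_le1; [apply: bruhat_refl|apply: bruhat_simpleL_dec].
(* [mul_fst] fixes the second coordinate, so either choice of [q'] has second coordinate
   [s i * q.2]. *)
move=> q' [Qq' eq' ->]; apply: IH => //; apply: leq_trans (_ : _ < len q.2) le_n.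
by case: eq' => ->; rewrite e.
Qed.

(** * From triples to bounded pairs *)

Lemma bruhat_div x u w : min_rep s J w -> parabolic s J u ->
  (len (x * u^-1) + len u)%N = len x -> x <=B w * u -> x * u^-1 <=B w.
Proof.
move=> mw Ju; move: u Ju x; apply: (parabolic_ind cox) => [|v j Jv Jj e IH] x.
  by rewrite invg1 !mulg1.
have -> : x * (v * s j)^-1 = x * s j * v^-1 by rewrite (mulVsimple cox) mulgA.
have -> : w * (v * s j) = w * v * s j by rewrite mulgA.
rewrite e => lx xwv.
(* Additivity of lengths makes [s j] a right descent of [x], and minimality of [w] makes it one of
   [w * v * s j], so lifting strips it from both. *)
have lxj : len x = (len (x * s j)).+1.
  have := cox_lengthM cox (x * s j * v^-1) v; rewrite mulgVK.
  by case: (len_simpleR cox x j); lia.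
apply: IH; first by lia.
rewrite -[w * v](mul_simpleK cox j); apply: bruhat_lift2R; rewrite // ?lxj //.
rewrite mul_simpleK // -mulgA !(min_rep_len cox mw) ?e //; first lia.
by apply: parabolicM => //; apply: parabolic_simple.
Qed.

(* a v1 is the Demazure product of a and v. *)
Lemma length_additive_factor a w v : min_rep s J w -> parabolic s J v ->
  exists v1, [/\ parabolic s J v1, w * v1 <=B w * v, a * v <=B a * v1
    & len (a * v1) = (len a + len v1)%N].
Proof.
move=> mw; move: v; apply: (parabolic_ind cox) => [|v j Jv Jj e [v1 [Jv1 le1 le2 l1]]].
  exists 1; rewrite !mulg1 (cox_length1 cox) addn0; split=> //; try exact: bruhat_refl.
  exact: parabolic1.
have Jsj := parabolic_simple cox Jj.
have lt : len (w * v) < len (w * v * s j).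
  rewrite -mulgA !(min_rep_len cox mw) ?e //; first lia.
  exact: parabolicM.
case: (len_simpleR cox (a * v1) j) => ea.
  have av1j : a * (v1 * s j) = a * v1 * s j by rewrite mulgA.
  exists (v1 * s j); rewrite av1j; split; first exact: parabolicM.
  - by rewrite !mulgA; apply: bruhat_liftR_up.
  - by rewrite mulgA; apply: bruhat_liftR_up; rewrite // ea.
  - have := cox_lengthM cox a (v1 * s j); have := len_simpleR cox v1 j.
    by rewrite av1j; lia.
exists v1; rewrite !mulgA; split=> //.
  by apply: bruhat_trans le1 _; apply: bruhat_simpleR.
by apply: bruhat_liftR; rewrite // [X in _ < X]ea.
Qed.

Definition pair_of_triple (t : W * W * W) : W * W :=
  let: (x, u, w) := t in (x * u^-1, w).

Lemma max_rep_div x u : max_rep s J x -> parabolic s J u ->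
  (len (x * u^-1) + len u)%N = len x.
Proof.
by move=> mx Ju; rewrite -(max_rep_len cox mx (parabolicV cox Ju)) cox_lengthV.
Qed.

Lemma pair_of_triple_bounded (t : W * W * W) : IJ s J t -> bounded_pair (pair_of_triple t).
Proof.
case: t => [[x u] w] [mx Ju mw le]; split=> //=.
by apply: bruhat_div => //; apply: max_rep_div.
Qed.

Lemma pair_of_triple_inj (t t' : W * W * W) : IJ s J t -> IJ s J t' ->
  pair_of_triple t = pair_of_triple t' -> t = t'.
Proof.
case: t t' => [[x u] w] [[x' u'] w'] [mx Ju _ _] [mx' Ju' _ _] [e ->].
have Jv : parabolic s J (u^-1 * u') by apply: parabolicM => //; apply: parabolicV.
have ex : x * (u^-1 * u') = x' by rewrite mulgA e mulgVK.
have v1 := max_rep_inj cox mx mx' Jv ex.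
have euu : u = u' by rewrite -[LHS]mulg1 -v1 mulVKg.
by rewrite -ex v1 mulg1 euu.
Qed.

(** Finiteness of [W_J] provides a maximal representative [x] of the coset of [a]; writing
    [a = x * u] gives the middle entry [u^-1]. *)
Lemma pair_of_triple_surj p : bounded_pair p ->
  exists2 t : W * W * W, IJ s J t & pair_of_triple t = p.
Proof.
case: p => a w [/= mw aw]; have [x [u [mx Ju e]]] := max_rep_exists cox a finJ.
exists (x, u^-1, w); last by rewrite /= invgK e.
split=> //; first exact: (parabolicV cox Ju).
by rewrite -[x](mulgK u) -e; apply: (bruhat_parabolic_mono cox mw) aw;
  apply: parabolicV.
Qed.

Lemma QJ_leE (t t' : W * W * W) : IJ s J t -> IJ s J t' ->
  QJ_le s J (Some t) (Some t') <-> pair_le (pair_of_triple t) (pair_of_triple t').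
Proof.
move=> It It'; have [+ +] := pair_of_triple_bounded It.
case: t t' It It' => [[x u] w] [[x' u'] w'] [mx Ju mw _] _ /= _ aw; split.
  move=> [u1 [u2 [[Ju1 Ju2 <- _] [le1 _ le3]]]]; exists u1 => //=; split=> //.
  by move: le1; rewrite /= invgM mulgA mulgVK.
move=> [v Jv /= [le1 le2]].
(* Passing from [v] to [v1] makes the lengths of [x * u^-1] and [v1] add. With [u1 = v1] and
   [u2 = v1^-1 * u], maximality of [x] turns this into [l(u) = l(u1) + l(u2)]. *)
have [v1 [Jv1 le3 le4 l1]] := length_additive_factor (x * u^-1) mw Jv.
have Jv2 : parabolic s J (v1^-1 * u) by apply: parabolicM => //; apply: parabolicV.
have e2 : x * u^-1 * v1 = x * (v1^-1 * u)^-1 by rewrite invgM invgK mulgA.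
exists v1, (v1^-1 * u); rewrite -e2; split; split=> //.
- by rewrite mulVKg.
- by have := max_rep_div mx Ju; have := max_rep_div mx Jv2; rewrite -e2; lia.
- exact: bruhat_trans le1 le4.
- exact: (bruhat_parabolic_mono cox mw Jv1 aw).
- exact: bruhat_trans le3 le2.
Qed.

(** * Rank, balance and the Eulerian property for triples *)

Definition QJ_rank (o : option (W * W * W)) : nat :=
  if o is Some t then (`|pair_rank (pair_of_triple t)|%N).+1 else 0%N.

Lemma QJ_le_None o : QJ_le s J o None -> o = None.
Proof. by case: o => [[[]]|]. Qed.

(** Makes the absolute value in [QJ_rank] harmless; the successor there reserves rank 0 for
    [None]. *)
Lemma pair_rank_ge0 p : bounded_pair p -> (0 <= pair_rank p)%R.
Proof. by case=> _ /bruhat_len; rewrite /pair_rank; lia. Qed.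

Lemma QJ_po : partial_order_on (QJ_le s J) (QJ s J).
Proof.
case: pair_le_po => rf anti tr; have B := pair_of_triple_bounded.
split=> [[t|//] It|[t|] [t'|] It It'|[t|//] [t'|] [t''|] It It' It'' //].
- by apply/QJ_leE => //; apply: rf; case: (B t It).
- move=> /(QJ_leE It It') le /(QJ_leE It' It) ge; congr Some.
  by apply: pair_of_triple_inj => //; apply: anti => //; [case: (B t It)|case: (B t' It')].
- by move=> /QJ_le_None.
- by move=> _ /QJ_le_None.
- by [].
- move=> /(QJ_leE It It') le1 /(QJ_leE It' It'') le2; apply/QJ_leE => //.
  by apply: tr le1 le2; [case: (B t It)|case: (B t' It')|case: (B t'' It'')].
- by move=> _ /QJ_le_None.
- by move=> /QJ_le_None.
Qed.

Lemma QJ_rank_lt o o' : QJ s J o -> QJ s J o' -> QJ_le s J o o' -> o <> o' ->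
  QJ_rank o < QJ_rank o'.
Proof.
case: o' => [t'|]; last by move=> _ _ /QJ_le_None ->.
case: o => [t|] //= It It' /(QJ_leE It It') le ne.
have [bt bt'] := (pair_of_triple_bounded It, pair_of_triple_bounded It').
have [r1 r2] := pair_le_rank bt.1 le.
have := pair_rank_ge0 bt; have := pair_rank_ge0 bt'.
have : pair_rank (pair_of_triple t) <> pair_rank (pair_of_triple t').
  by move=> /r2 /(_ bt'.1) /(pair_of_triple_inj It It') e; apply: ne; rewrite e.
by move: r1; lia.
Qed.

Lemma QJ_rank_gap o o' : QJ s J o -> QJ s J o' -> QJ_le s J o o' ->
  (QJ_rank o).+1 < QJ_rank o' ->
  exists z, [/\ QJ s J z, QJ_le s J o z, QJ_le s J z o', z <> o & z <> o'].
Proof.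
case: o' => [t'|]; last by move=> _ _ /QJ_le_None ->.
case: o => [t|] It It'; have bt' := pair_of_triple_bounded It'; last first.
  (* Above [None], the pair [(w', w')] gives an element of rank 1 below [t']. *)
  move=> _ lt; pose p := pair_of_triple t'.
  have bp : bounded_pair (p.2, p.2) by split; [exact: bt'.1|exact: bruhat_refl].
  have [t0 I0 e0] := pair_of_triple_surj bp.
  exists (Some t0); split=> //.
    apply/QJ_leE => //; rewrite e0; apply: pair_le1; [exact: bt'.2|].
    exact: bruhat_refl.
  move=> [e]; move: lt; rewrite /QJ_rank -e e0 /pair_rank /=.
  by rewrite GRing.subrr.
move=> /(QJ_leE It It') le /= lt; have bt := pair_of_triple_bounded It.
have ne : pair_of_triple t <> pair_of_triple t' by move=> e; rewrite e in lt; lia.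
have [_ [e|[z [Az z1 z2 z3 z4]]]] := coset_pair_balanced bt'.1 bt.1 le ne.
  by have := pair_rank_ge0 bt; move: e lt; lia.
have [t0 I0 e0] := pair_of_triple_surj (bounded_pair_up bt Az z1).
exists (Some t0); split=> //; try by apply/QJ_leE => //; rewrite e0.
- by move=> [e]; apply: z3; rewrite -e0 e.
- by move=> [e]; apply: z4; rewrite -e0 e.
Qed.

(** The value [(1, 1)] is a default, never taken since the domain excludes [None]. *)
Lemma QJ_lower_image (t' : W * W * W) : IJ s J t' ->
  set_bij [set o | QJ s J o /\ o <> None /\ QJ_le s J o (Some t')]
    [set p | bounded_pair p /\ pair_le p (pair_of_triple t')]
    (fun o => if o is Some t then pair_of_triple t else (1, 1)).
Proof.
move=> It'; split=> [[t|] [It [ne le]] //|[t|] [t0|]|p [bp le]].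
- by split; [apply: pair_of_triple_bounded|apply/QJ_leE].
- by move=> /set_mem[It _] /set_mem[It0 _] /(pair_of_triple_inj It It0) ->.
- by move=> _ /set_mem[_ [[]]].
- by move=> /set_mem[_ [[]]].
- by move=> /set_mem[_ [[]]].
- have [t It e] := pair_of_triple_surj bp; exists (Some t) => //.
  by split=> //; split=> //; apply/QJ_leE => //; rewrite e.
Qed.

Lemma QJ_lower_finite (t' : W * W * W) : IJ s J t' ->
  finite_set [set o | QJ s J o /\ o <> None /\ QJ_le s J o (Some t')].
Proof.
move=> /QJ_lower_image[fS fI _]; rewrite -(eq_finite_set (inj_card_eq fI)).
apply: sub_finite_set (bounded_pair_lower_finite (pair_of_triple t')) => _ [o So <-].
exact: fS.
Qed.

Lemma QJ_interval_finite o o' : QJ s J o -> QJ s J o' ->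
  finite_set (interval_in (QJ_le s J) (QJ s J) o o').
Proof.
move=> _; case: o' => [t' It'|_]; last first.
  by apply: (@sub_finite_set _ _ [set None]) => // x [_ _ /QJ_le_None].
apply: (@sub_finite_set _ _
  ([set None] `|` [set o | QJ s J o /\ o <> None /\ QJ_le s J o (Some t')])).
  by move=> [t|] [Io _ le]; [right|left].
by rewrite finite_setU; split=> //; apply: QJ_lower_finite.
Qed.

Lemma odd_QJ_rank (t : W * W * W) :
  odd `|pair_rank (pair_of_triple t)| = odd (QJ_rank (Some t)) (+) true.
Proof. by rewrite /= addbT negbK. Qed.

Lemma QJ_balanced o o' : QJ s J o -> QJ s J o' -> QJ_le s J o o' -> o <> o' ->
  signed_count (odd \o QJ_rank) (interval_in (QJ_le s J) (QJ s J) o o') = 0%R.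
Proof.
case: o' => [t'|] Io It'; last by move=> /QJ_le_None.
have bij := QJ_lower_image It'; have bt' := pair_of_triple_bounded It'.
set f := (X in set_bij _ _ X) in bij.
case: o Io => [t|] It le ne; last first.
  have -> : interval_in (QJ_le s J) (QJ s J) None (Some t') =
      [set None] `|` [set o | QJ s J o /\ o <> None /\ QJ_le s J o (Some t')].
    apply/seteqP; split=> [[t|] [It0 _ le0]|_ [->|[Io [_ le0]]]] //.
    - by right.
    - by left.
  rewrite signed_countU //; [|exact: QJ_lower_finite|by move=> _ [-> [_ []]]].
  rewrite signed_count1 /=.
  (* The successor in [QJ_rank] flips signs, so the count 1 of bounded pairs becomes -1 and cancels
     the term of [None]. *)
  have := bounded_pair_lower_count bt'.
  rewrite (@signed_count_bij _ _ f _ _ _ (odd \o QJ_rank) true bij).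
    by rewrite /= => e; lia.
  by move=> [t0|] [_ [ne0 _]] //; rewrite odd_QJ_rank.
have bt := pair_of_triple_bounded It; have ple := (QJ_leE It It').1 le.
have tN : ~ QJ_le s J (Some t) None by move/QJ_le_None.
have [|cnt _] := coset_pair_balanced bt'.1 bt.1 ple.
  by move=> /(pair_of_triple_inj It It') e; apply: ne; rewrite e.
move: cnt; rewrite (@signed_count_bij _ _ f
  (interval_in (QJ_le s J) (QJ s J) (Some t) (Some t')) _ _ (odd \o QJ_rank) true).
- by rewrite GRing.expr1 GRing.mulN1r => e; lia.
- have [fS fI fO] := bij; split=> [[t0|] [I0 le1 le2] //|x y|p [mp le1 le2]].
  + by split; [case: (pair_of_triple_bounded I0)|apply/QJ_leE|apply/QJ_leE].
  + move=> /set_mem[Ix le1 le2] /set_mem[Iy le3 le4]; apply: fI; apply/mem_set.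
      by split=> //; split=> //; case: x le1 {Ix le2}.
    by split=> //; split=> //; case: y le3 {Iy le4}.
  + have bp := bounded_pair_up bt mp le1.
    have [t0 I0 e0] := pair_of_triple_surj bp; exists (Some t0) => //.
    by split=> //; apply/QJ_leE => //; rewrite e0.
- by move=> [t0|] [I0 le1 le2] //; rewrite odd_QJ_rank.
Qed.

Lemma QJ_interval_eulerian o o' : QJ s J o -> QJ s J o' -> QJ_le s J o o' ->
  eulerian (QJ_le s J) (interval_in (QJ_le s J) (QJ s J) o o').
Proof.
move=> Io Io' le; apply: (ranked_poset_eulerian QJ_po QJ_rank_lt QJ_rank_gap
  QJ_interval_finite QJ_balanced) => //.
Qed.

(** The top comes from the pair [(1, w)] with [w] the minimal representative of the coset of the
    greatest element. A minimal [d] stays below while the letters of [u] are stripped, since each of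
    them lengthens [d]. *)
Lemma QJ_greatest : finite_set [set: W] ->
  exists2 t : W * W * W, IJ s J t & forall o, QJ s J o -> QJ_le s J o (Some t).
Proof.
move=> /(bruhat_greatest cox)[w0 max_w0].
have [w [u [mw Ju e]]] := min_rep_exists cox J w0.
have min_le d : min_rep s J d -> d <=B w.
  move=> md; have := max_w0 d; rewrite e.
  move: u Ju {e}; apply: (parabolic_ind cox) => [|v j Jv Jj ev IH].
    by rewrite mulg1.
  rewrite mulgA => le; apply: IH; rewrite -[w * v](mul_simpleK cox j).
  apply: bruhat_liftR_min => //; first exact: (min_rep_simple_lt cox md).
  rewrite mul_simpleK // -mulgA !(min_rep_len cox mw) ?ev //; first lia.
  by apply: parabolicM => //; apply: parabolic_simple.
have b1 : bounded_pair (1, w) by split=> //; apply: bruhat_1.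
have [t It et] := pair_of_triple_surj b1; exists t => // -[t0|//] I0.
apply/QJ_leE => //; rewrite et; have [m0 _] := pair_of_triple_bounded I0.
by apply: pair_le1; [apply: bruhat_1|apply: min_le].
Qed.
End CosetPairs.

Theorem corollary6p8 (I : Type) (W : groupType) (s : I -> W) (J : set I) :
  coxeter_system s ->
  finite_set (parabolic s J) ->
  locally_eulerian (QJ_le s J) (QJ s J) /\
  (finite_set [set: W] -> eulerian (QJ_le s J) (QJ s J)).
Proof.
move=> cox finJ; split.
  split; first exact: QJ_po.
    by exists None; split=> // -[].
  by move=> o o' Io Io' le; apply: QJ_interval_eulerian.
move=> /(QJ_greatest cox finJ)[t It top].
(* For finite [W] the whole poset is the interval from [None] to the greatest element. *)
have := QJ_interval_eulerian cox finJ (o := None) (o' := Some t) Logic.I It Logic.I.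
congr eulerian; apply/seteqP; split=> [o []//|o Io]; split=> //; exact: top.
Qed.
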